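(* Let $F,F'\in W$ and let $Gl_F$ act by conjugation inside $\mathrm{Aut}_gA_C$. a) $Gl_F$ acts on $V_F$, and as a $Gl_F$-module $V_F=\bigoplus E_F^*$ (a direct sum of copies of $E_F^*$). b) If $F'<F$, then $Gl_F$ acts on $V_k$ for each $v_k\in F'$, and $V_k=\bigoplus_{n_i}S^{n_i}(E_F)$ as a $Gl_F$-module, for some finite family of integers $n_i\ge 0$. c) If $F'\nleq F$, then $Gl_F$ acts on $V_{F'}$ trivially. In particular $Gl_F$ acts on $V_{F'}$ for all $F'\in W$.
   Context: The base field $k$ is algebraically closed of characteristic $0$ (the letter $k$ is also used as an index). $M$ is a free $\mathbb Z$-module of finite rank, $M^*=\mathrm{Hom}_{\mathbb Z}(M,\mathbb Z)$, $T_M=\mathrm{Spec}\,k[M]$. $X$ is a complete toric variety over $k$ with torus $T_M$, given by a fan $\Delta$ in $M^*\otimes\mathbb Q$. The rays of $\Delta$ are identified with their primitive generators (epimorphisms) $v_i:M\to\mathbb Z$; $\Delta_1=\{v_1,\dots,v_r\}$ is the set of rays and $H_1,\dots,H_r$ are the corresponding $T_M$-invariant irreducible hypersurfaces. $N$ is the Weil divisor class group of $X$, with exact sequence $0\to M\xrightarrow{v}\mathbb Z^r\xrightarrow{\pi}N\to0$, $v(\alpha)=(v_1(\alpha),\dots,v_r(\alpha))$, $\pi(n_1,\dots,n_r)=[\sum n_iH_i]$. $A_C=k[y_1,\dots,y_r]$ is graded by $N$ via $\deg y^n=\pi(n)$. $\mathrm{Aut}_gA_C$ is the affine algebraic group of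 $N$-graded $k$-algebra automorphisms of $A_C$. Roots: $v_i$ also denotes the $i$-th coordinate $\mathbb Z^r\to\mathbb Z$. A root associated to $v_i$ is an element $\rho\in\ker\pi=v(M)$ with $v_i(\rho)=-1$ and $v_j(\rho)\ge0$ for all $j\ne i$. A root $\rho$ is semisimple if $-\rho$ is also a root; it is associated to $(v_i,v_j)$ if $\rho$ is associated to $v_i$ and $-\rho$ to $v_j$. Define $v_i\equiv v_j$ if $v_i=v_j$ or there is a semisimple root associated to $(v_i,v_j)$ (an equivalence relation); $W=\Delta_1/\equiv$. Write $v_i<v_j$ if there is a non-semisimple root $\rho$ associated to $v_i$ with $v_j(\rho)>0$; for $F,F'\in W$ write $F<F'$ if $v_i<v_j$ for some $v_i\in F$, $v_j\in F'$. This is a (strict) partial order on $W$. Let $\rho_1,\dots,\rho_m$ be all the non-semisimple roots associated to $v_i$. For $t=(t_1,\dots,t_m)$ let $\tau_t$ be the graded automorphism of $A_C$ with $\tau_t(y^n)=y^n(1+t_1y^{\rho_1}+\dots+t_my^{\rho_m})^{v_i(n)}$, $n\in\mathbb N^r$. $V_i$ is the image of the injective group morphism $\mathbb A^m\to\mathrm{Aut}_gA_C$, $t\mapsto\tau_t$; it is regarded as the underlying additive group of the $k$-vector space with basis the derivations $y^{\rho_1}D_{v_i},\dots,y^{\rho_m}D_{v_i}$, where $D_{v_i}(y^n)=v_i(n)y^n$ ($V_i=0$ if $m=0$). For $F\in W$, $V_F=\prod_{v_i\in F}V_i$, an additive (vector) subgroup of $\mathrm{Aut}_gA_C$. For $F\in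 W$, $E_F$ is the $k$-vector space with basis $\{y_i\}_{v_i\in F}$, $E_F^*$ its dual, $S^nE_F$ its $n$-th symmetric power. $Gl_F=\mathrm{Aut}_kE_F$ is the linear group, viewed as a subgroup of $\mathrm{Aut}_gA_C$ by acting linearly on the variables $\{y_i\}_{v_i\in F}$ and by the identity on the other variables. *)

(* Defs.v *)
From HB Require Import structures.
From mathcomp Require Import all_boot all_order all_algebra.
From mathcomp Require Import boolp classical_sets cardinality finmap.
(* monalg redefines the notations of mpoly for another model of polynomials. *)
From mathcomp Require Import -(notations) monalg.
From mathcomp Require Import mpoly.

Set Implicit Arguments.
Unset Strict Implicit.
Unset Printing Implicit Defensive.

Import Order.TTheory GRing.Theory Num.Theory.
Local Open Scope ring_scope.

(* M is Z^d (row vectors), M^* = Hom(M, Z) is the module of column vectors, the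
   pairing is the matrix product; likewise over the rationals. *)
Section Fans.
Local Open Scope classical_set_scope.
Variable d : nat.
Implicit Types (s t : set 'cV[rat]_d) (Delta : set (set 'cV[rat]_d)).

Definition cone (gs : seq 'cV[rat]_d) : set 'cV[rat]_d :=
  [set x | exists2 c : 'I_(size gs) -> rat,
     forall i, 0 <= c i & x = \sum_i c i *: gs`_i].

Definition polyhedral s := exists gs, s = cone gs.

Definition strongly_convex s := forall x, s x -> s (- x) -> x = 0.

Definition dual_cone s : set 'rV[rat]_d :=
  [set u | forall x, s x -> 0 <= (u *m x) 0 0].

Definition face t s :=
  exists2 u, dual_cone s u & t = s `&` [set x | u *m x = 0].

Definition is_fan Delta :=
  [/\ finite_set Delta,
      forall s, Delta s -> polyhedral s /\ strongly_convex s,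
      forall s t, Delta s -> face t s -> Delta t
    & forall s t, Delta s -> Delta t -> face (s `&` t) s /\ face (s `&` t) t].

Definition complete_fan Delta :=
  is_fan Delta /\ forall x, exists2 s, Delta s & s x.

(* u, seen as a homomorphism M -> Z, is onto *)
Definition primitive (u : 'cV[int]_d) :=
  forall z : int, exists a : 'rV[int]_d, (a *m u) 0 0 = z.

Definition ray (u : 'cV[int]_d) := cone [:: map_mx intr u].

(* The columns of v are the primitive generators v_1, ..., v_r of the rays of
   Delta, each listed once; thus a |-> a *m v is (v_1, ..., v_r) : M -> Z^r. *)
Definition is_rays Delta r (v : 'M[int]_(d, r)) :=
  (forall i j, col i v = col j v -> i = j) /\
  (forall u, (primitive u /\ Delta (ray u)) <-> exists i, u = col i v).

End Fans.

(* 0 -> M --v--> Z^r --pi--> N -> 0 is exact *)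
Definition short_exact d r (N : zmodType) (v : 'M[int]_(d, r))
    (pi : {additive 'rV[int]_r -> N}) :=
  [/\ injective (fun a : 'rV[int]_d => a *m v),
      forall n, pi n = 0 <-> exists a : 'rV[int]_d, n = a *m v
    & forall c, exists n, pi n = c].

(* The index i stands for the ray v_i, so v_i(rho) is rho 0 i, and W consists of
   sets of indices. *)
Section Roots.
Variables (r : nat) (N : zmodType) (pi : {additive 'rV[int]_r -> N}).
Implicit Types (i j : 'I_r) (rho : 'rV[int]_r) (F : {set 'I_r}).

Definition is_root i rho :=
  [/\ pi rho = 0, rho 0 i = -1 & forall j, j != i -> 0 <= rho 0 j].

Definition semisimple_root i j rho := is_root i rho /\ is_root j (- rho).

Definition nonss_root i rho :=
  is_root i rho /\ ~ exists j, is_root j (- rho).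

Definition veq i j := i = j \/ exists rho, semisimple_root i j rho.

Definition vlt i j := exists2 rho, nonss_root i rho & 0 < rho 0 j.

Definition W : {set {set 'I_r}} :=
  equivalence_partition (fun i j => `[< veq i j >]) [set: 'I_r].

Definition classlt F F' := exists i j, [/\ i \in F, j \in F' & vlt i j].

Definition classle F F' := F = F' \/ classlt F F'.

Definition nsroot i := {rho : 'rV[int]_r | `[< nonss_root i rho >]}.

Definition mnm_row (m : 'X_{1..r}) : 'rV[int]_r := \row_j (m j)%:Z.

Definition ndeg (m : 'X_{1..r}) : N := pi (mnm_row m).

End Roots.

(* A = k[y_1, ..., y_r] is graded by N via deg y^m = pi m. *)
Section GradedAut.
Variables (k : fieldType) (r : nat) (N : zmodType).
Variable pi : {additive 'rV[int]_r -> N}.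
Local Notation A := {mpoly k[r]}.

Definition in_deg (c : N) (p : A) := {in msupp p, forall m, ndeg pi m = c}.

Definition graded_endo (f : A -> A) :=
  [/\ linear f, monoid_morphism f & forall c p, in_deg c p -> in_deg c (f p)].

Record graut := GrAut {
  graut_fun :> A -> A;
  graut_inv : A -> A;
  graut_endo : graded_endo graut_fun;
  graut_inv_endo : graded_endo graut_inv;
  graut_funK : cancel graut_fun graut_inv;
  graut_invK : cancel graut_inv graut_fun }.

Lemma graut_ext (a b : graut) : graut_fun a =1 graut_fun b -> a = b.
Proof.
case: a b => [f f' e e' c c'] [g g' h h' q q'] /= /funext efg.
have efg' : f' = g'.
  by apply/funext => p; rewrite -[RHS](c (g' p)) efg q'.
by subst; congr GrAut; exact: Prop_irrelevance.
Qed.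

Lemma graded_endo_id : graded_endo id.
Proof. by split=> //; split. Qed.

Lemma graded_endo_comp f g :
  graded_endo f -> graded_endo g -> graded_endo (f \o g).
Proof.
case=> lf [f1 fM] gf [lg [g1 gM] gg]; split=> [a p q /=||c p hp /=].
- by rewrite lg lf.
- by split=> [|p q] /=; rewrite ?g1 ?f1 // gM fM.
- exact/gf/gg.
Qed.

Definition graut_one : graut :=
  @GrAut id id graded_endo_id graded_endo_id (fun=> erefl) (fun=> erefl).

Definition graut_mul (a b : graut) : graut :=
  @GrAut (a \o b) (graut_inv b \o graut_inv a)
    (graded_endo_comp (graut_endo a) (graut_endo b))
    (graded_endo_comp (graut_inv_endo b) (graut_inv_endo a))
    (can_comp (graut_funK a) (graut_funK b))
    (can_comp (graut_invK b) (graut_invK a)).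

Definition graut_V (a : graut) : graut :=
  @GrAut (graut_inv a) a (graut_inv_endo a) (graut_endo a)
    (graut_invK a) (graut_funK a).

HB.instance Definition _ := gen_eqMixin graut.
HB.instance Definition _ := gen_choiceMixin graut.

Fact graut_mulA : associative graut_mul.
Proof. by move=> a b c; apply: graut_ext. Qed.
Fact graut_mul1 : left_id graut_one graut_mul.
Proof. by move=> a; apply: graut_ext. Qed.
Fact graut_mulr1 : right_id graut_one graut_mul.
Proof. by move=> a; apply: graut_ext. Qed.
Fact graut_mulV : left_inverse graut_one graut_V graut_mul.
Proof. by move=> a; apply: graut_ext => p; exact: graut_funK. Qed.
Fact graut_mulrV : right_inverse graut_one graut_V graut_mul.
Proof. by move=> a; apply: graut_ext => p; exact: graut_invK. Qed.

HB.instance Definition _ := isGroup.Build graut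
  graut_mulA graut_mul1 graut_mulr1 graut_mulV graut_mulrV.

Lemma grautM (a b : graut) p : (a * b)%g p = a (b p).
Proof. by []. Qed.

Lemma in_deg0 c : in_deg c 0.
Proof. by move=> m; rewrite msupp0. Qed.

Lemma in_degD c p q : in_deg c p -> in_deg c q -> in_deg c (p + q).
Proof. by move=> hp hq m /msuppD_le; rewrite mem_cat => /orP[/hp|/hq]. Qed.

Lemma in_degZ c a p : in_deg c p -> in_deg c (a *: p).
Proof. by move=> hp m /msuppZ_le /hp. Qed.

Lemma in_deg_sum c (I : Type) (s : seq I) (P : pred I) (F : I -> A) :
  (forall i, P i -> in_deg c (F i)) -> in_deg c (\sum_(i <- s | P i) F i).
Proof.
by move=> h; elim/big_ind: _ => [|p q|//]; [exact: in_deg0 | exact: in_degD].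
Qed.

Lemma mnm_rowD m1 m2 :
  mnm_row (m1 + m2)%MM = mnm_row m1 + mnm_row m2 :> 'rV[int]_r.
Proof. by apply/rowP => j; rewrite !mxE mnmDE PoszD. Qed.

Lemma in_degX m : in_deg (ndeg pi m) 'X_[m].
Proof. by move=> m'; rewrite msuppX inE => /eqP ->. Qed.

Lemma in_deg1 : in_deg 0 1.
Proof.
move=> m; rewrite msupp1 inE => /eqP ->; rewrite /ndeg.
by rewrite -[RHS](raddf0 pi); congr (pi _); apply/rowP => j; rewrite !mxE mnmE.
Qed.

Lemma in_degM c e p q : in_deg c p -> in_deg e q -> in_deg (c + e) (p * q).
Proof.
move=> hp hq m /msuppM_le/allpairsP[[m1 m2] /= [/hp <- /hq <- ->]].
by rewrite /ndeg mnm_rowD raddfD.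
Qed.

Lemma in_degXn c p n : in_deg c p -> in_deg (c *+ n) (p ^+ n).
Proof.
move=> hp; elim: n => [|n IH]; first by rewrite mulr0n expr0; exact: in_deg1.
by rewrite exprS mulrS; exact: in_degM.
Qed.

Lemma comp_homog (lq : r.-tuple A) :
    (forall j, in_deg (ndeg pi U_(j)%MM) (tnth lq j)) ->
  forall c p, in_deg c p -> in_deg c (p \mPo lq).
Proof.
move=> hlq c p hp; rewrite comp_mpolyEX big_seq.
apply: in_deg_sum => m /hp <-; apply: in_degZ; rewrite comp_mpolyX.
have -> : ndeg pi m = \sum_(j < r) ndeg pi U_(j)%MM *+ m j.
  rewrite /ndeg; under eq_bigr do rewrite -raddfMn.
  rewrite -raddf_sum; congr (pi _); apply/rowP => i.
  rewrite summxE mxE (bigD1 i) //= big1 ?addr0 => [|j nji];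
    rewrite mulmxnE mxE mnmE.
    by rewrite eqxx pmulrn intz.
  by rewrite (negbTE nji) mul0rn.
elim/big_ind2: _ => [|c1 p1 c2 p2|j _]; first exact: in_deg1.
- exact: in_degM.
- exact/in_degXn/hlq.
Qed.

Lemma comp_endo (lq : r.-tuple A) :
    (forall j, in_deg (ndeg pi U_(j)%MM) (tnth lq j)) ->
  graded_endo (comp_mpoly lq).
Proof.
move=> hlq; split; first exact: linearP; last exact: comp_homog.
by split; [exact: rmorph1 | exact: rmorphM].
Qed.

Lemma comp_comp (lq lq' : r.-tuple A) :
    (forall j, tnth lq j \mPo lq' = 'X_j) ->
  cancel (comp_mpoly lq) (comp_mpoly lq').
Proof.
move=> h p; rewrite (comp_mpolyEX p) [RHS]mpolyE raddf_sum /=.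
apply: eq_bigr => m _; rewrite comp_mpolyZ comp_mpolyX rmorph_prod /=.
congr (_ *: _); rewrite [RHS]mpolyXE_id; apply: eq_bigr => j _.
by rewrite rmorphXn /= h.
Qed.

End GradedAut.

(* The group of automorphisms of the space E = k^n of column vectors *)
Section GL.
Variables (k : fieldType) (n : nat).

Record GL := MkGL { GLmx :> 'M[k]_n; GLmx_unit : GLmx \in unitmx }.

HB.instance Definition _ := [isSub for GLmx].
HB.instance Definition _ := [Choice of GL by <:].

Definition GL_one : GL := MkGL (unitmx1 k n).

Fact GL_mul_subproof (g h : GL) : g *m h \in unitmx.
Proof. by rewrite unitmx_mul !GLmx_unit. Qed.
Definition GL_mul (g h : GL) : GL := MkGL (GL_mul_subproof g h).

Fact GL_inv_subproof (g : GL) : invmx g \in unitmx.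
Proof. by rewrite unitmx_inv GLmx_unit. Qed.
Definition GL_inv (g : GL) : GL := MkGL (GL_inv_subproof g).

Fact GL_mulA : associative GL_mul.
Proof. by move=> g h l; apply/val_inj/mulmxA. Qed.
Fact GL_mul1 : left_id GL_one GL_mul.
Proof. by move=> g; apply/val_inj/mul1mx. Qed.
Fact GL_mulr1 : right_id GL_one GL_mul.
Proof. by move=> g; apply/val_inj/mulmx1. Qed.
Fact GL_mulV : left_inverse GL_one GL_inv GL_mul.
Proof. by move=> g; apply/val_inj/mulVmx/GLmx_unit. Qed.
Fact GL_mulrV : right_inverse GL_one GL_inv GL_mul.
Proof. by move=> g; apply/val_inj/mulmxV/GLmx_unit. Qed.

HB.instance Definition _ := isGroup.Build GL
  GL_mulA GL_mul1 GL_mulr1 GL_mulV GL_mulrV.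

(* E^*, with (g l)(x) = l(g^-1 x) *)
Definition dual_act (g : GL) (l : 'rV[k]_n) : 'rV[k]_n := l *m invmx g.

(* S^e E is the space of forms of degree e in the basis y_1, ..., y_n of E. *)
Definition lin_forms (g : GL) : n.-tuple {mpoly k[n]} :=
  [tuple \sum_a g a b *: 'X_a | b < n].

Fact sym_act_subproof e (g : GL) (p : dhomog n k e) :
  (p : {mpoly k[n]}) \mPo lin_forms g \is e.-homog.
Proof.
case: p => p /= hp; rewrite comp_mpolyEX big_seq; apply: rpred_sum => m.
move/(dhomog_mf hp); rewrite /= mdegE => <-; apply: rpredZ; rewrite comp_mpolyX.
elim/big_ind2: _ => [|e1 p1 e2 p2|b _]; first exact: dhomog1.
- exact: dhomogM.
suff /(dhomogMn (m b)) : tnth (lin_forms g) b \is 1.-homog by rewrite mul1n.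
rewrite tnth_mktuple.
by apply: rpred_sum => a _; apply: rpredZ; rewrite dhomogX /= mdeg1.
Qed.
Definition sym_act e (g : GL) (p : dhomog n k e) : dhomog n k e :=
  DHomog (sym_act_subproof g p).

End GL.

Section DProd.
Variables (k : fieldType) (I : finType) (V : I -> lmodType k).

Definition dprod := {dffun forall i, V i}.
HB.instance Definition _ := Choice.on dprod.
Implicit Types u w x : dprod.

Definition dprod_zero : dprod := [ffun i => 0 : V i].
Definition dprod_opp u : dprod := [ffun i => - u i].
Definition dprod_add u w : dprod := [ffun i => u i + w i].
Definition dprod_scale (a : k) u : dprod := [ffun i => a *: u i].

Fact dprod_addA : associative dprod_add.
Proof. by move=> u w x; apply/ffunP=> i; rewrite !ffunE addrA. Qed.
Fact dprod_addC : commutative dprod_add.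
Proof. by move=> u w; apply/ffunP=> i; rewrite !ffunE addrC. Qed.
Fact dprod_add0 : left_id dprod_zero dprod_add.
Proof. by move=> u; apply/ffunP=> i; rewrite !ffunE add0r. Qed.
Fact dprod_addN : left_inverse dprod_zero dprod_opp dprod_add.
Proof. by move=> u; apply/ffunP=> i; rewrite !ffunE addNr. Qed.

HB.instance Definition _ := GRing.isZmodule.Build dprod
  dprod_addA dprod_addC dprod_add0 dprod_addN.

Fact dprod_scaleA a b u :
  dprod_scale a (dprod_scale b u) = dprod_scale (a * b) u.
Proof. by apply/ffunP=> i; rewrite !ffunE scalerA. Qed.
Fact dprod_scale1 : left_id 1 dprod_scale.
Proof. by move=> u; apply/ffunP=> i; rewrite !ffunE scale1r. Qed.
Fact dprod_scaleDr : right_distributive dprod_scale +%R.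
Proof. by move=> a u w; apply/ffunP=> i; rewrite !ffunE scalerDr. Qed.
Fact dprod_scaleDl u : {morph dprod_scale^~ u : a b / a + b}.
Proof. by move=> a b; apply/ffunP=> i; rewrite !ffunE scalerDl. Qed.

HB.instance Definition _ := GRing.Zmodule_isLmodule.Build k dprod
  dprod_scaleA dprod_scale1 dprod_scaleDr dprod_scaleDl.

Definition dprod_act (G : Type) (act : forall i, G -> V i -> V i)
  (g : G) (u : dprod) : dprod := [ffun i => act i g (u i)].

End DProd.

Section Representations.
Variables (k : fieldType) (G : groupType).

Definition is_rep (V : lmodType k) (act : G -> V -> V) :=
  [/\ forall g, linear (act g), act 1%g =1 id
    & forall g h, act (g * h)%g =1 act g \o act h].

Definition rep_iso (V V' : lmodType k) (act : G -> V -> V)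
    (act' : G -> V' -> V') :=
  exists2 f : {linear V -> V'}, bijective f
    & forall g x, f (act g x) = act' g (f x).

(* Via iota, G acts by conjugation on the subgroup of H which is the image of
   exp : V -> H; the action on V is act, and it is k-linear. *)
Definition conj_rep (H : groupType) (iota : G -> H) (V : lmodType k)
    (exp : V -> H) (act : G -> V -> V) :=
  is_rep act /\
  forall g x, exp (act g x) = (iota g * exp x * (iota g)^-1)%g.

End Representations.

Section Subgroups.
Variables (k : fieldType) (r : nat) (N : zmodType).
Variable pi : {additive 'rV[int]_r -> N}.
Local Notation A := {mpoly k[r]}.
Implicit Types (i j : 'I_r) (F : {set 'I_r}).

(* V_i: the space with basis the nonsemisimple roots associated to v_i, the root
   rho standing for the derivation y^rho D_{v_i}. *)
Definition Vi i := malg (nsroot pi i) k.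

(* The exponent of y_i y^rho, which is in N^r when rho is a root associated
   to v_i. *)
Definition root_mnm i (rho : 'rV[int]_r) : 'X_{1..r} :=
  [multinom absz (rho 0 j + (j == i)%:Z)%R | j < r].

Definition root_poly i (t : Vi i) : A :=
  \sum_(rho <- monalg.msupp t) monalg.mcoeff rho t *: 'X_[root_mnm i (val rho)].

(* tau_t is determined by y_i |-> y_i (1 + sum t_rho y^rho), y_j |-> y_j for
   j != i; its values on all monomials are given in tau_monomial. *)
Definition tau_tuple i (t : Vi i) : r.-tuple A :=
  [tuple 'X_j + (if j == i then root_poly t else 0) | j < r].

Lemma nsrootP i (rho : nsroot pi i) : nonss_root pi i (val rho).
Proof. by apply/asboolP; exact: (valP rho). Qed.

Lemma root_mnmE i (rho : nsroot pi i) :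
  mnm_row (root_mnm i (val rho)) = val rho + mnm_row U_(i)%MM.
Proof.
have [[_ ri rj] _] := nsrootP rho; apply/rowP => j.
rewrite !mxE !mnmE eq_sym gez0_abs // ; case: (eqVneq i j) => [<-|nij].
  by rewrite ri addNr.
by rewrite addr0 rj // eq_sym.
Qed.

Lemma root_mnm_i i (rho : nsroot pi i) : root_mnm i (val rho) i = 0%N.
Proof. by have [[_ ri _] _] := nsrootP rho; rewrite mnmE ri eqxx. Qed.

Lemma root_mnm_ndeg i (rho : nsroot pi i) :
  ndeg pi (root_mnm i (val rho)) = ndeg pi U_(i)%MM.
Proof.
by have [[r0 _ _] _] := nsrootP rho; rewrite /ndeg root_mnmE raddfD r0 add0r.
Qed.

Lemma root_polyE i :
  @root_poly i =1 monalg.mmap (@mpolyC r k) (fun rho => 'X_[root_mnm i (val rho)]).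
Proof.
by move=> t; rewrite monalg.mmapE; apply: eq_bigr => rho _; rewrite mul_mpolyC.
Qed.

Lemma root_polyD i : {morph @root_poly i : t u / t + u}.
Proof. by move=> t u; rewrite !root_polyE monalg.mmapD. Qed.

Lemma root_polyN i : {morph @root_poly i : t / - t}.
Proof. by move=> t; rewrite !root_polyE monalg.mmapN. Qed.

Lemma tau_tuple_homog i (t : Vi i) j :
  in_deg pi (ndeg pi U_(j)%MM) (tnth (tau_tuple t) j).
Proof.
rewrite tnth_mktuple; apply: in_degD; first exact: in_degX.
case: eqP => [->|_]; last exact: in_deg0.
apply: in_deg_sum => rho _; apply: in_degZ.
by rewrite -(root_mnm_ndeg rho); exact: in_degX.
Qed.

Lemma root_poly_tau i (t u : Vi i) :
  root_poly t \mPo tau_tuple u = root_poly t.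
Proof.
rewrite raddf_sum /=; apply: eq_bigr => rho _; rewrite comp_mpolyZ comp_mpolyX.
congr (_ *: _); rewrite [RHS]mpolyXE_id; apply: eq_bigr => j _.
rewrite tnth_mktuple; case: eqP => [->|_]; last by rewrite addr0.
by rewrite root_mnm_i !expr0.
Qed.

Lemma comp_tau i (t u : Vi i) j :
  tnth (tau_tuple t) j \mPo tau_tuple u = tnth (tau_tuple (t + u)) j.
Proof.
rewrite !tnth_mktuple comp_mpolyD comp_mpolyXU -tnth_nth tnth_mktuple.
case: eqP => _; last by rewrite comp_mpoly0 addr0.
by rewrite root_poly_tau root_polyD -addrA [_ + root_poly t]addrC.
Qed.

Lemma tau_tuple0 i j : tnth (tau_tuple (0 : Vi i)) j = 'X_j.
Proof.
rewrite tnth_mktuple; case: eqP => _; last by rewrite addr0.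
by rewrite root_polyE monalg.mmap0 addr0.
Qed.

Fact tau_can i (t u : Vi i) : t + u = 0 ->
  cancel (comp_mpoly (tau_tuple t)) (comp_mpoly (tau_tuple u)).
Proof. by move=> tu; apply: comp_comp => j; rewrite comp_tau tu tau_tuple0. Qed.

Definition tau i (t : Vi i) : graut k pi :=
  @GrAut k r N pi (comp_mpoly (tau_tuple t)) (comp_mpoly (tau_tuple (- t)))
    (comp_endo (@tau_tuple_homog i t)) (comp_endo (@tau_tuple_homog i (- t)))
    (tau_can (subrr t)) (tau_can (addNr t)).

Local Notation "x %:F" := (@FracField.tofrac A x).

(* y^rho as a rational function *)
Definition laurent (rho : 'rV[int]_r) : {fraction A} :=
  \prod_j (('X_j)%:F : {fraction A}) ^ (rho 0 j).

Lemma laurent_root i (rho : nsroot pi i) :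
  ('X_i)%:F * laurent (val rho) = ('X_[root_mnm i (val rho)])%:F.
Proof.
have [[_ ri rj] _] := nsrootP rho.
have X0 j : ('X_j)%:F != 0 :> {fraction A}.
  by rewrite tofrac_eq0 -msupp_eq0 msuppX.
rewrite [in RHS]mpolyXE_id rmorph_prod /laurent (bigD1 i) //= [RHS](bigD1 i) //=.
rewrite root_mnm_i ri expr0 tofrac1 mulrA exprN1 divff // !mul1r.
apply: eq_bigr => j nji; rewrite mnmE (negbTE nji) addr0 rmorphXn /=.
by rewrite -{1}(gez0_abs (rj j nji)).
Qed.

Lemma tau_monomial i (t : Vi i) (n : 'X_{1..r}) :
  (tau t 'X_[n])%:F = ('X_[n])%:F *
    (1 + \sum_(rho <- monalg.msupp t)
           (monalg.mcoeff rho t)%:MP%:F * laurent (val rho)) ^+ n i.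
Proof.
rewrite /= comp_mpolyX mpolyXE_id !rmorph_prod /=.
rewrite (bigD1 i) //= [in RHS](bigD1 i) //= mulrAC; congr (_ * _).
  rewrite tnth_mktuple eqxx !rmorphXn /= -exprMn; congr (_ ^+ _).
  rewrite mulrDr mulr1 rmorphD /= rmorph_sum mulr_sumr; congr (_ + _).
  apply: eq_bigr => rho _.
  by rewrite mulrCA laurent_root -mul_mpolyC rmorphM.
by apply: eq_bigr => j nji; rewrite tnth_mktuple (negbTE nji) addr0.
Qed.

Lemma tauD i : {morph @tau i : t u / t + u >-> (t * u)%g}.
Proof.
move=> t u; apply: graut_ext => p; rewrite grautM /= addrC.
rewrite !(comp_mpolyEX p) raddf_sum /=; apply: eq_bigr => m _.
rewrite comp_mpolyZ !comp_mpolyX rmorph_prod; congr (_ *: _).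
by apply: eq_bigr => j _; rewrite rmorphXn /= comp_tau.
Qed.

Lemma tau_inj i : injective (@tau i).
Proof.
move=> t u /(congr1 (fun a : graut k pi => a 'X_i)) /=.
rewrite !comp_mpolyXU -!tnth_nth !tnth_mktuple eqxx => /addrI /eqP.
rewrite -subr_eq0 -root_polyN -root_polyD => /eqP tu0.
apply/eqP; rewrite -subr_eq0; apply/eqP; move: (t - u) tu0 => {t u} t t0.
have mI : injective (fun rho : nsroot pi i => root_mnm i (val rho)).
  move=> x y /(congr1 (@mnm_row r)); rewrite !root_mnmE => /addIr; exact: val_inj.
apply/monalg.malgP => rho; rewrite monalg.mcoeff0.
have [|/monalg.mcoeff_outdom //] := boolP (rho \in monalg.msupp t).
move=> rt; move/(congr1 (mcoeff (root_mnm i (val rho)))): t0.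
rewrite mcoeff0 raddf_sum /= (bigD1_seq rho) //= big1 => [|x nx].
  by rewrite addr0 mcoeffZ mcoeffX eqxx mulr1.
by rewrite mcoeffZ mcoeffX (inj_eq mI) (negbTE nx) mulr0.
Qed.

(* V_F, as a vector space the product of the V_i, v_i in F *)
Definition VF F := dprod (fun i : {i | i \in F} => Vi (val i)).

Definition tauF F (t : VF F) : graut k pi :=
  (\prod_(i : {i | i \in F}) tau (t i))%g.

(* E_F = k^#|F| with the b-th basis vector standing for y_(enum_val b), so that
   g in Gl_F sends y_(enum_val b) to the sum over a of g_ab y_(enum_val a). *)
Definition gl_tuple F (g : 'M[k]_#|F|) : r.-tuple A :=
  [tuple if j \in F
         then \sum_(b | enum_val b == j) \sum_a g a b *: 'X_(enum_val a)
         else 'X_j | j < r].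

Lemma W_ndeg F i j : F \in W pi -> i \in F -> j \in F ->
  ndeg pi U_(i)%MM = ndeg pi U_(j)%MM.
Proof.
have veq_ndeg x y : veq pi x y -> ndeg pi U_(x)%MM = ndeg pi U_(y)%MM.
  case=> [->//|[rho [[r0 rx rge] [_ ry rle]]]].
  have {}ry : rho 0 y = 1 by rewrite -[LHS]opprK; move: ry; rewrite mxE => ->.
  have nyx : y != x by apply/eqP => eyx; move: rx; rewrite -eyx ry.
  suff e : mnm_row U_(y)%MM = rho + mnm_row U_(x)%MM.
    by rewrite /ndeg e raddfD r0 add0r.
  apply/rowP => l; rewrite !mxE !mnmE.
  case: (eqVneq x l) => [<-|nxl]; first by rewrite (negbTE nyx) rx.
  case: (eqVneq y l) => [<-|nyl]; first by rewrite ry.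
  apply/eqP; rewrite eq_le addr0 rge 1?eq_sym //=.
  by rewrite -oppr_ge0; have := rle l; rewrite mxE; apply; rewrite eq_sym.
case/imsetP => x _ -> /[!inE] /andP[_ /asboolP xi] /andP[_ /asboolP xj].
by rewrite -(veq_ndeg _ _ xi) -(veq_ndeg _ _ xj).
Qed.

Lemma gl_tuple_homog F (g : 'M[k]_#|F|) j : F \in W pi ->
  in_deg pi (ndeg pi U_(j)%MM) (tnth (gl_tuple g) j).
Proof.
move=> FW; rewrite tnth_mktuple; case: ifP => [jF|_]; last exact: in_degX.
apply: in_deg_sum => b _; apply: in_deg_sum => a _; apply: in_degZ.
by rewrite (W_ndeg FW jF (enum_valP a)); exact: in_degX.
Qed.

Lemma gl_tuple_in F (g : 'M[k]_#|F|) b :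
  tnth (gl_tuple g) (enum_val b) = \sum_a g a b *: 'X_(enum_val a).
Proof.
rewrite tnth_mktuple enum_valP (big_pred1 b) // => c.
exact: (inj_eq enum_val_inj).
Qed.

Lemma gl_tuple_out F (g : 'M[k]_#|F|) j :
  j \notin F -> tnth (gl_tuple g) j = 'X_j.
Proof. by rewrite tnth_mktuple => /negbTE ->. Qed.

Lemma comp_gl F (g h : 'M[k]_#|F|) j :
  tnth (gl_tuple g) j \mPo gl_tuple h = tnth (gl_tuple (h *m g)) j.
Proof.
have [jF|jF] := boolP (j \in F); last first.
  by rewrite !gl_tuple_out // comp_mpolyXU -tnth_nth gl_tuple_out.
rewrite -(enum_rankK_in jF jF) !gl_tuple_in raddf_sum /=.
under eq_bigr => a _ do
  rewrite comp_mpolyZ comp_mpolyXU -tnth_nth gl_tuple_in scaler_sumr.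
rewrite exchange_big /=; apply: eq_bigr => c _.
rewrite mxE scaler_suml; apply: eq_bigr => a _.
by rewrite scalerA mulrC.
Qed.

Lemma gl_tuple1 F j : tnth (gl_tuple (1%:M : 'M[k]_#|F|)) j = 'X_j.
Proof.
have [jF|jF] := boolP (j \in F); last by rewrite gl_tuple_out.
rewrite -(enum_rankK_in jF jF) gl_tuple_in (bigD1 (enum_rank_in jF j)) //=.
rewrite mxE eqxx scale1r big1 ?addr0 // => a /negbTE na.
by rewrite mxE na scale0r.
Qed.

Fact gl_can F (g h : 'M[k]_#|F|) : h *m g = 1%:M ->
  cancel (comp_mpoly (gl_tuple g)) (comp_mpoly (gl_tuple h)).
Proof. by move=> hg; apply: comp_comp => j; rewrite comp_gl hg gl_tuple1. Qed.

Definition gl_aut F (FW : F \in W pi) (g : GL k #|F|) : graut k pi :=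
  @GrAut k r N pi (comp_mpoly (gl_tuple g)) (comp_mpoly (gl_tuple (invmx g)))
    (comp_endo (fun j => @gl_tuple_homog F g j FW))
    (comp_endo (fun j => @gl_tuple_homog F (invmx g) j FW))
    (gl_can (mulVmx (GLmx_unit g))) (gl_can (mulmxV (GLmx_unit g))).

Lemma gl_aut_in F (FW : F \in W pi) (g : GL k #|F|) b :
  gl_aut FW g 'X_(enum_val b) = \sum_a (g : 'M_#|F|) a b *: 'X_(enum_val a).
Proof. by rewrite /= comp_mpolyXU -tnth_nth gl_tuple_in. Qed.

Lemma gl_aut_out F (FW : F \in W pi) (g : GL k #|F|) j :
  j \notin F -> gl_aut FW g 'X_j = 'X_j.
Proof. by move=> jF; rewrite /= comp_mpolyXU -tnth_nth gl_tuple_out. Qed.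

Lemma gl_autM F (FW : F \in W pi) : {morph gl_aut FW : g h / (g * h)%g}.
Proof.
move=> g h; apply: graut_ext => p; rewrite grautM /=.
rewrite !(comp_mpolyEX p) raddf_sum /=; apply: eq_bigr => m _.
rewrite comp_mpolyZ !comp_mpolyX rmorph_prod; congr (_ *: _).
by apply: eq_bigr => j _; rewrite rmorphXn /= comp_gl.
Qed.

End Subgroups.

(* Main.v *)
(* Completeness enters only through one fact: an element of ker pi with
   nonnegative entries is 0. Indeed a linear form that is negative somewhere is
   negative on some ray, found by descending through faces of the fan. Together
   with Dickson's lemma this makes each graded piece of A_C finite-dimensional.

   Two variables are equivalent exactly when they have the same degree, and
   rho |-> y_i y^rho identifies the non-semisimple roots associated to v_i, i in F,
   with the monomials of degree deg y_i in which no variable of F occurs. So V_F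
   consists of the automorphisms y_i |-> y_i + p_i (i in F) with p_i in the span P
   of these monomials. The group Gl_F fixes P and transforms (p_i) like coordinates
   on E_F, which gives E_F^* (x) P. For F' <> F, conjugation by g in Gl_F replaces
   p_i by g(p_i); splitting off the part of each monomial in the variables of F,
   which all have the same non-torsion degree, decomposes the span of the p_i into
   symmetric powers of E_F. If no variable of F occurs in them, g acts trivially. *)

Require Import Defs.
From HB Require Import structures.
From mathcomp Require Import all_boot all_order all_algebra.
From mathcomp Require Import boolp classical_sets functions cardinality finmap.
From mathcomp Require Import -(notations) monalg.
From mathcomp Require Import mpoly.

Set Implicit Arguments.
Unset Strict Implicit.
Unset Printing Implicit Defensive.

Import Order.TTheory GRing.Theory Num.Theory.
Local Open Scope ring_scope.

(** * Complete fans: a linear form nonnegative on all rays is zero *)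

Section CompleteFan.
Local Open Scope classical_set_scope.
Variable d : nat.
Implicit Types (s t : set 'cV[rat]_d) (Delta : set (set 'cV[rat]_d)).
Implicit Types (u a b : 'rV[rat]_d) (x : 'cV[rat]_d).

Definition dot u x : rat := (u *m x) 0 0.

Lemma dotBl u a x : dot (u - a) x = dot u x - dot a x.
Proof. by rewrite /dot mulmxBl !mxE. Qed.

Lemma dotNl u x : dot (- u) x = - dot u x.
Proof. by rewrite /dot mulNmx mxE. Qed.

Lemma dotZl c u x : dot (c *: u) x = c * dot u x.
Proof. by rewrite /dot -scalemxAl mxE. Qed.

Lemma dotNr u x : dot u (- x) = - dot u x.
Proof. by rewrite /dot mulmxN mxE. Qed.

Lemma dotZr c u x : dot u (c *: x) = c * dot u x.
Proof. by rewrite /dot -scalemxAr mxE. Qed.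

Lemma dot_sumr u (I : finType) (f : I -> 'cV[rat]_d) :
  dot u (\sum_i f i) = \sum_i dot u (f i).
Proof. by rewrite /dot mulmx_sumr summxE. Qed.

Lemma dot_mul0 u x : (u *m x = 0) <-> (dot u x = 0).
Proof.
rewrite /dot; split=> [->|h]; first by rewrite mxE.
by apply/matrixP => i j; rewrite !ord1 h mxE.
Qed.

Lemma dot_delta u j : dot u (delta_mx j 0) = u 0 j.
Proof. by rewrite /dot -colE mxE. Qed.

Lemma dot_delta_mx x j : dot (delta_mx 0 j) x = x j 0.
Proof. by rewrite /dot -rowE mxE. Qed.

Lemma cone_gen gs (i : 'I_(size gs)) : @cone d gs gs`_i.
Proof.
exists (fun j => (j == i)%:R) => [j|]; first exact: ler0n.
rewrite (bigD1 i) //= eqxx scale1r big1 ?addr0 // => j /negbTE ->.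
by rewrite scale0r.
Qed.

Lemma coneZ gs c x : 0 <= c -> @cone d gs x -> cone gs (c *: x).
Proof.
move=> c0 [f f0 ->]; exists (fun i => c * f i) => [i|]; first exact: mulr_ge0.
by rewrite scaler_sumr; apply: eq_bigr => i _; rewrite scalerA.
Qed.

Lemma cone_dual gs u :
  (forall i : 'I_(size gs), 0 <= dot u gs`_i) -> dual_cone (cone gs) u.
Proof.
move=> h x [c c0 ->]; rewrite -/(dot _ _) dot_sumr.
by apply: sumr_ge0 => i _; rewrite dotZr mulr_ge0.
Qed.

Definition positive_on s u := forall x, s x -> x != 0 -> 0 < dot u x.

Lemma cone_neq0 gs x : @cone d gs x -> x != 0 ->
  exists i : 'I_(size gs), gs`_i != 0.
Proof.
move=> [c _ ->] nz; apply/existsP; apply: contraNT nz => /existsPn h.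
by rewrite big1 // => i _; move: (h i); rewrite negbK => /eqP ->; rewrite scaler0.
Qed.

(* The slope is the least ratio b/p on the generators; on the face, b is
   proportional to p. *)
Lemma slope_face gs p b x : positive_on (cone gs) p -> cone gs x -> x != 0 ->
  exists lam, dual_cone (cone gs) (b - lam *: p) /\
    exists y, [/\ cone gs y, y != 0 & dot (b - lam *: p) y = 0].
Proof.
move=> pp sx nx; have [i0 i0P] := cone_neq0 sx nx.
pose f (i : 'I_(size gs)) := dot b gs`_i / dot p gs`_i.
case: (@Order.TotalTheory.arg_minP _ _ _ i0 (fun i => gs`_i != 0) f i0P) => i iP imin.
have pgt0 (j : 'I_(size gs)) : gs`_j != 0 -> 0 < dot p gs`_j by apply: pp; exact: cone_gen.
exists (f i); split.
  apply: cone_dual => j; rewrite dotBl dotZl subr_ge0.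
  have [->|nj] := eqVneq gs`_j 0; first by rewrite /dot !mulmx0 !mxE mulr0.
  by rewrite -ler_pdivlMr ?pgt0 //; exact: imin.
exists gs`_i; split=> //; first exact: cone_gen.
by rewrite dotBl dotZl /f divfK ?subrr // gt_eqF // pgt0.
Qed.

Variable Delta : set (set 'cV[rat]_d).
Hypothesis hDelta : complete_fan Delta.

Lemma fan_face s u : Delta s -> dual_cone s u ->
  Delta (s `&` [set x | u *m x = 0]).
Proof. by move=> Ds us; case: hDelta => -[_ _ hf _] _; apply: hf Ds _; exists u. Qed.

(* By completeness -x lies in a cone t, and the face of s cut out by t misses x
   by strong convexity of t. *)
Lemma fan_separate s x : Delta s -> s x -> x != 0 ->
  exists2 u, dual_cone s u & 0 < dot u x.
Proof.
case: hDelta => -[_ hc _ hi] hcov Ds sx nx; have [t Dt tx] := hcov (- x).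
have [[u us e] _] := hi s t Ds Dt; exists u => //.
rewrite lt_neqAle (us _ sx) andbT eq_sym; apply: contraNneq nx => ux.
have [_ t0] := hc t Dt; apply/eqP/t0 => //.
suff [] : (s `&` t) x by [].
by rewrite e; split=> //; apply/dot_mul0.
Qed.

(** Each nonzero generator has a form of the dual cone positive on it, and the sum of these forms
    works: where it vanishes on the cone, all of them do, which kills the coefficient of every
    nonzero generator. *)
Lemma fan_positive s : Delta s -> exists u, positive_on s u.
Proof.
move=> Ds; case: (hDelta) => -[_ hc _ _] _; have [[gs e] _] := hc s Ds.
have H (i : 'I_(size gs)) : exists u, dual_cone s u /\ (gs`_i != 0 -> 0 < dot u gs`_i).
  have [->|nz] := eqVneq gs`_i 0.
    by exists 0; split=> // x _; rewrite mul0mx mxE.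
  have sg : s gs`_i by rewrite e; exact: cone_gen.
  by have [u us ux] := fan_separate Ds sg nz; exists u.
have [U hU] := choice H; exists (\sum_i U i) => x; rewrite e => -[c c0 ex] nx.
have dE y : dot (\sum_i U i) y = \sum_i dot (U i) y.
  by rewrite /dot mulmx_suml summxE.
have ge0 i y : s y -> 0 <= dot (U i) y by case: (hU i) => h _; exact: h.
have sx : s x by rewrite e ex; exists c.
rewrite lt_neqAle dE sumr_ge0 ?andbT => [|i _]; last exact: ge0.
apply: contraNneq nx => /esym x0.
have {}x0 i : dot (U i) x = 0.
  apply/eqP; move/eqP: x0; rewrite psumr_eq0 => [/allP/(_ i)|j _]; last exact: ge0.
  by rewrite mem_index_enum; apply.
rewrite ex big1 // => i _.
have [->|nz] := eqVneq gs`_i 0; first by rewrite scaler0.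
suff -> : c i = 0 by rewrite scale0r.
move: (x0 i); rewrite ex dot_sumr => /eqP; rewrite psumr_eq0 => [|j _]; last first.
  by rewrite dotZr mulr_ge0 // ge0 // e; exact: cone_gen.
move/allP/(_ i); rewrite mem_index_enum => /(_ isT) /=; rewrite dotZr mulf_eq0.
by have [_ /(_ nz) /gt_eqF ->] := hU i; rewrite orbF => /eqP.
Qed.

Lemma fan_slope_face s p b x : Delta s -> positive_on s p -> s x -> x != 0 ->
  exists lam t, [/\ Delta t, t `<=` s, exists2 y, t y & y != 0,
    dual_cone s (b - lam *: p) & forall y, t y -> dot b y = lam * dot p y].
Proof.
move=> Ds pp sx nx; case: (hDelta) => -[_ hc _ _] _; have [[gs e] _] := hc s Ds.
rewrite e in pp sx; have [lam [ld [y [sy ny y0]]]] := slope_face b pp sx nx.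
exists lam, (s `&` [set x | (b - lam *: p) *m x = 0]); rewrite e; split=> //.
- by rewrite -e; apply: fan_face => //; rewrite e.
- by exists y => //; split=> //; apply/dot_mul0.
- move=> z [_ /dot_mul0 /eqP]; rewrite dotBl dotZl subr_eq0 => /eqP //.
Qed.

(** After clearing denominators, the Smith form of an integer column shows it as a multiple of a
    column of a unimodular matrix, which is primitive because the inverse matrix has a row pairing
    to 1 with it. *)
Lemma primitive_multiple x : x != 0 -> exists (w : 'cV[int]_d) (c : rat),
  [/\ primitive w, 0 < c & x = c *: map_mx intr w].
Proof.
move=> nx; case: d x nx => [|n] x nx; first by rewrite flatmx0 eqxx in nx.
pose D : int := \prod_i denq (x i 0).
have D0 : 0 < D by apply: prodr_gt0 => i _; exact: denq_gt0.
pose w : 'cV[int]_n.+1 := \col_i (numq (x i 0) * \prod_(j | j != i) denq (x j 0)).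
have wE : map_mx intr w = D%:~R *: x.
  apply/colP => i; rewrite !mxE.
  have -> : D = denq (x i 0) * \prod_(j | j != i) denq (x j 0) by rewrite /D (bigD1 i).
  by rewrite !intrM numqE [RHS]mulrC mulrA.
have [L Lu [R Ru [dd _ e]]] := int_Smith_normal_form w.
pose z := dd`_0 * R 0 0.
have {}e : w = z *: col 0 L.
  rewrite e; apply/colP => i; rewrite !mxE big_ord1 !mxE (bigD1 0) //= big1 => [|j nj].
    by rewrite !mxE addr0 mulr1n -mulrA mulrC.
  by rewrite !mxE [_ == _](negbTE nj) mulr0n mulr0.
have prim : primitive (col 0 L).
  move=> y; exists (y *: row 0 (invmx L)); rewrite -scalemxAl mxE.
  by rewrite colE mulmxA -row_mul mulVmx // -colE !mxE mulr1.
have nz : z != 0.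
  apply: contraNneq nx => z0; rewrite z0 scale0r in e.
  move/eqP: wE; rewrite e map_mx0 eq_sym scaler_eq0 intr_eq0 gt_eqF //=.
have xE : x = (D%:~R^-1 * z%:~R) *: map_mx intr (col 0 L).
  rewrite -scalerA -[X in _ *: X](_ : map_mx intr w = _); last first.
    by rewrite e; apply/colP => i; rewrite !mxE intrM.
  by rewrite wE scalerA mulVf ?scale1r // intr_eq0 gt_eqF.
have Dp : 0 < (D%:~R^-1 : rat) by rewrite invr_gt0 ltr0z.
(* The factor [z] may be negative; its sign is then moved into the primitive vector. *)
case: (ltgtP z 0) nz => // zs _.
  exists (- col 0 L), (D%:~R^-1 * (- z)%:~R); split.
  - move=> y; have [a ea] := prim y; exists (- a).
    by rewrite mulmxN mulNmx opprK.
  - by rewrite mulr_gt0 // ltr0z oppr_gt0.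
  - by rewrite xE; apply/colP => i; rewrite !mxE !intrN !mulrN mulNr opprK.
exists (col 0 L), (D%:~R^-1 * z%:~R); split=> //.
by rewrite mulr_gt0 // ltr0z.
Qed.

Variables (r : nat) (v : 'M[int]_(d, r)).
Hypothesis hv : is_rays Delta v.

(* Cutting out slope faces of a and then of all the coordinates shrinks a cone on
   which a is somewhere negative to a ray on which a is negative. *)
Lemma fan_ray_neg a x : dot a x < 0 ->
  exists i, dot a (map_mx intr (col i v)) < 0.
Proof.
move=> ax; case: (hDelta) => -[_ hc _ _] hcov; have [s Ds sx] := hcov x.
have nx : x != 0 by apply: contraTneq ax => ->; rewrite /dot mulmx0 mxE ltxx.
have [u up] := fan_positive Ds.
have [lam [t [Dt ts tn lamd tE]]] := fan_slope_face a Ds up sx nx.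
(* The slope is negative because [lam * dot u x <= dot a x < 0]. *)
have lam0 : lam < 0.
  have := lamd _ sx; rewrite -/(dot _ _) dotBl dotZl subr_ge0 => h.
  by move: (le_lt_trans h ax); rewrite pmulr_llt0 // up.
have {s Ds sx x ax nx u up lam lamd lam0 ts tE} tp : positive_on t (- a).
  move=> y ty ny; rewrite dotNl tE // oppr_gt0 pmulr_llt0 ?lam0 //.
  by apply: up => //; exact: ts.
(* It suffices to find a nonzero cone of the fan on which every coordinate is a multiple of [- a]:
   such a cone is a half-line. *)
suff [s [Ds [x sx nx] sp [c sE]]] : exists s, [/\ Delta s, exists2 x, s x & x != 0,
    positive_on s (- a) &
    exists c : 'I_d -> rat, forall y (j : 'I_d), s y -> y j 0 = c j * dot (- a) y].
  have [w [e [wprim e0 xE]]] := primitive_multiple nx.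
  have ap : 0 < dot (- a) x by exact: sp.
  have sE' y : s y -> y = (dot (- a) y / dot (- a) x) *: x.
    move=> sy; apply/colP => j; rewrite !mxE !sE //.
    by rewrite mulrCA divfK ?gt_eqF.
  have sray : s = ray w.
    have [[gs egs] _] := hc s Ds; apply/seteqP; split=> y.
      move=> sy; exists (fun=> (dot (- a) y / dot (- a) x) * e) => [_|].
        rewrite mulr_ge0 ?(ltW e0) // divr_ge0 ?(ltW ap) //.
        have [->|ny] := eqVneq y 0; first by rewrite /dot mulmx0 mxE.
        exact/ltW/sp.
      by rewrite big_ord1 /= -scalerA -xE -sE'.
    case=> c' c0' ->; rewrite big_ord1 /= egs.
    have -> : map_mx intr w = e^-1 *: x :> 'cV[rat]_d.
      by rewrite xE scalerA mulVf ?scale1r // gt_eqF.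
    by rewrite scalerA; apply: coneZ; rewrite -?egs // divr_ge0 // ltW.
  have [_ hr] := hv; have [i wi] : exists i, w = col i v.
    by apply/hr; rewrite -sray.
  exists i; rewrite -wi; move: ap; rewrite xE dotZr pmulr_rgt0 // dotNl.
  by rewrite oppr_gt0.
suff H n : (n <= d)%N -> exists s, [/\ Delta s, exists2 x, s x & x != 0,
    positive_on s (- a) & exists c : 'I_d -> rat,
      forall y (j : 'I_d), (j < n)%N -> s y -> y j 0 = c j * dot (- a) y].
  have [s [Ds sx sp [c sE]]] := H d (leqnn d).
  by exists s; split=> //; exists c => y j; exact: sE.
elim: n => [_|n IH nd]; first by exists t; split=> //; exists (fun=> 0).
have [s [Ds [x sx nx] sp [c sE]]] := IH (ltnW nd).
(* The form used here is the coordinate of index [n]; passing to a smaller cone keeps the earlier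
   relations. *)
have [mu [t' [Dt' ts' tn' _ tE']]] :=
  fan_slope_face (delta_mx 0 (Ordinal nd)) Ds sp sx nx.
exists t'; split=> //; first by move=> y /ts'; exact: sp.
exists (fun j => if j == Ordinal nd then mu else c j) => y j jn ty.
case: eqP => [->|/eqP nj]; first by rewrite -tE' // dot_delta_mx.
apply: sE; last exact: ts'.
by move: jn; rewrite ltnS leq_eqVlt => /orP[/eqP jn|//]; case/eqP: nj; apply: val_inj.
Qed.

(** By [fan_ray_neg] such a form is nowhere negative, and being nonnegative at both [x] and [- x] it
    vanishes. *)
Lemma fan_rays_span a :
  (forall i, 0 <= dot a (map_mx intr (col i v))) -> a = 0.
Proof.
move=> ha; have h x : 0 <= dot a x.
  by rewrite leNgt; apply/negP => /fan_ray_neg[i]; rewrite ltNge ha.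
apply/rowP => j; apply/eqP; rewrite mxE -dot_delta eq_le h andbT.
by rewrite -oppr_ge0 -dotNr.
Qed.

(** The entries of [a *m v] are the values of [a] on the ray generators. Geometrically, a character
    that is regular on a complete variety is trivial. *)
Lemma ker_ge0_eq0 (N : zmodType) (pi : {additive 'rV[int]_r -> N})
    (hpi : short_exact v pi) n :
  pi n = 0 -> (forall j, 0 <= n 0 j) -> n = 0.
Proof.
case: hpi => _ hk _ /hk[a ->] an.
suff : map_mx intr a = 0 :> 'rV[rat]_d.
  move/rowP => a0; suff -> : a = 0 by rewrite mul0mx.
  by apply/rowP => j; move: (a0 j); rewrite !mxE => /eqP; rewrite intr_eq0 => /eqP.
apply: fan_rays_span => i; rewrite /dot -map_mxM mxE ler0z.
by rewrite colE mulmxA -colE mxE.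
Qed.

End CompleteFan.

(** * Dickson's lemma *)

Lemma nat_monotone_subseq (f : nat -> nat) : exists s : nat -> nat,
  {homo s : i j / (i < j)%N} /\ {homo f \o s : i j / (i <= j)%N}.
Proof.
(* The subsequence runs through the positions of successive tail minima, whose values never
   decrease. *)
have tail_min n : exists m, (n <= m)%N /\ forall p, (n <= p)%N -> (f m <= f p)%N.
  have ex : exists y, `[< exists2 m, (n <= m)%N & f m = y >].
    by exists (f n); apply/asboolP; exists n.
  case: (ex_minnP ex) => _ /asboolP[m nm <-] ymin; exists m; split=> // p np.
  by apply: ymin; apply/asboolP; exists p.
have [g gP] := choice tail_min.
pose s n := iter n (fun m => g m.+1) (g 0%N).
have sS n : (s n < s n.+1)%N by have [] := gP (s n).+1.
exists s; split; first by apply: (homo_ltn ltn_trans) => n.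
apply: (homo_leq leqnn leq_trans) => n /=.
case: n => [|n]; first by have [_ h] := gP 0%N; apply: h.
have [_ h] := gP (s n).+1; apply: h.
exact: leq_trans (sS n) (ltnW (sS n.+1)).
Qed.

(** Monotone subsequences are extracted for one exponent after another; any two terms of the last
    one are comparable. *)
Lemma dickson r (f : nat -> 'X_{1..r}) :
  exists i j, (i < j)%N /\ (f i <= f j)%MM.
Proof.
suff H n : (n <= r)%N -> exists s : nat -> nat, {homo s : i j / (i < j)%N} /\
    forall l : 'I_r, (l < n)%N -> {homo (fun i => f (s i) l) : i j / (i <= j)%N}.
  have [s [s1 s2]] := H r (leqnn r); exists (s 0%N), (s 1%N); split; first exact: s1.
  by apply/mnm_lepP => l; apply: s2.
elim: n => [_|n IH nr]; first by exists id; split=> [i j|l].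
have [s [s1 s2]] := IH (ltnW nr).
have [q [q1 q2]] := nat_monotone_subseq (fun i => f (s i) (Ordinal nr)).
exists (s \o q); split=> [i j ij|l]; first exact/s1/q1.
rewrite ltnS leq_eqVlt => /orP[/eqP ln|ln] i j ij /=.
  by have -> : l = Ordinal nr; [exact: val_inj | exact: q2].
by apply: s2 => //; exact: (ltnW_homo q1).
Qed.

(** * Pointed gradings: finite graded pieces, classes of variables, roots as monomials *)

Section PointedGrading.
Variables (r : nat) (N : zmodType) (pi : {additive 'rV[int]_r -> N}).
Hypothesis pointed : forall n, pi n = 0 -> (forall j, 0 <= n 0 j) -> n = 0.
Implicit Types (i j : 'I_r) (m : 'X_{1..r}) (F : {set 'I_r}).
Local Notation deg i := (ndeg pi U_(i)%MM).

Lemma mnm_row_inj : injective (@mnm_row r).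
Proof.
by move=> m m' /rowP e; apply/mnmP => j; have := e j; rewrite !mxE => -[].
Qed.

Lemma ndegD m m' : ndeg pi (m + m')%MM = ndeg pi m + ndeg pi m'.
Proof. by rewrite /ndeg mnm_rowD raddfD. Qed.

Lemma ndeg_eq0 m : ndeg pi m = 0 -> m = 0%MM.
Proof.
move=> /pointed e; apply: mnm_row_inj; rewrite e => [|j]; last by rewrite mxE.
by apply/rowP => j; rewrite !mxE mnm0E.
Qed.

(** The quotient of the two monomials has degree 0, so it is 1. *)
Lemma ndeg_antichain m m' : ndeg pi m = ndeg pi m' -> (m <= m')%MM -> m = m'.
Proof.
move=> e le; rewrite -(submK le) (_ : (m' - m)%MM = 0%MM) ?add0m //.
by apply/ndeg_eq0/(addIr (ndeg pi m)); rewrite -ndegD submK // add0r.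
Qed.

(** An infinite piece would contain a sequence of distinct monomials, and Dickson's lemma would make
    one of them divide another, against [ndeg_antichain]. *)
Lemma finite_ndeg c : exists X : {fset 'X_{1..r}}, forall m, ndeg pi m = c -> m \in X.
Proof.
suff /finite_fsetP[X e] : finite_set [set m | ndeg pi m = c]%classic.
  by exists X => m mc; have : [set` X]%classic m by rewrite -e.
apply: contrapT => /infiniteP /card_leP[f].
pose h (n : nat) := val (f (to_setT n)).
have hc n : ndeg pi (h n) = c by have := set_valP (f (to_setT n)).
have [i [j [ij le]]] := dickson h.
have /val_inj := ndeg_antichain (etrans (hc i) (esym (hc j))) le.
move/(@inj _ _ _ f) => e; move: ij; suff -> : i = j by rewrite ltnn.
by have /(congr1 val) := e (mem_setT _) (mem_setT _).
Qed.

(** The sign conditions at both ends leave a semisimple root only the form $y_j/y_i$, and this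
    quotient has degree 0 exactly when the two degrees agree. *)
Lemma veqP i j : veq pi i j <-> deg i = deg j.
Proof.
split=> [[->//|[rho [[r0 rx rge] [_ ry rle]]]]|e].
  have {}ry : rho 0 j = 1 by rewrite -[LHS]opprK; move: ry; rewrite mxE => ->.
  have nij : i != j by apply/eqP => eij; move: rx; rewrite eij ry.
  suff e : mnm_row U_(j)%MM = rho + mnm_row U_(i)%MM.
    by rewrite /ndeg e raddfD r0 add0r.
  apply/rowP => l; rewrite !mxE !mnmE.
  have [<-|nil] := eqVneq i l; first by rewrite eq_sym (negbTE nij) rx.
  have [<-|njl] := eqVneq j l; first by rewrite ry.
  apply/eqP; rewrite eq_le addr0 rge 1?eq_sym //=.
  by rewrite -oppr_ge0; have := rle l; rewrite mxE; apply; rewrite eq_sym.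
have [->|nij] := eqVneq i j; [by left | right].
exists (mnm_row U_(j)%MM - mnm_row U_(i)%MM); split; split.
- by rewrite raddfB -!/(ndeg _ _) e subrr.
- by rewrite !mxE !mnmE eqxx eq_sym (negbTE nij).
- by move=> l nl; rewrite !mxE !mnmE [i == l]eq_sym (negbTE nl) subr0.
- by rewrite raddfN raddfB -!/(ndeg _ _) e subrr oppr0.
- by rewrite !mxE !mnmE eqxx (negbTE nij).
- by move=> l nl; rewrite !mxE !mnmE [j == l]eq_sym (negbTE nl) sub0r opprK.
Qed.

Lemma W_mem F i j : F \in W pi -> i \in F -> (j \in F) = (deg j == deg i).
Proof.
case/imsetP => x _ -> /[!inE] /andP[_ /asboolP/veqP xi] /=.
by apply/asboolP/eqP => [/veqP <-|e]; [|apply/veqP; rewrite e].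
Qed.

Lemma W_neq0 F : F \in W pi -> exists i, i \in F.
Proof. by case/imsetP => x _ ->; exists x; rewrite !inE; apply/asboolP/veqP. Qed.

Lemma W_notin F F' i : F \in W pi -> F' \in W pi -> F != F' -> i \in F -> i \notin F'.
Proof.
move=> FW FW' nF iF; apply: contra nF => iF'; apply/eqP/setP => j.
by rewrite (W_mem _ FW iF) (W_mem _ FW' iF').
Qed.

Definition outer_mnm c F m := ndeg pi m = c /\ forall j, j \in F -> m j = 0%N.

Lemma outer_mnm_seq c F : exists2 s : seq 'X_{1..r}, uniq s &
  forall m, (m \in s) <-> outer_mnm c F m.
Proof.
have [X XP] := finite_ndeg c.
exists [seq m <- (X : seq _) | `[< outer_mnm c F m >]] => [|m].
  by rewrite filter_uniq // fset_uniq.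
rewrite mem_filter; split=> [/andP[/asboolP]//|h].
by rewrite XP ?andbT; [apply/asboolP | case: h].
Qed.

(** A variable $y_j$ of $F$ dividing $y_i y^\rho$ has the same degree, so the two are equal by
    [ndeg_antichain]; then $y^\rho = y_j/y_i$ would be semisimple. *)
Lemma outer_root F i (rho : nsroot pi i) : F \in W pi -> i \in F ->
  outer_mnm (deg i) F (root_mnm i (val rho)).
Proof.
move=> FW iF; split=> [|j jF]; first exact: root_mnm_ndeg.
have [_ nss] := nsrootP rho; apply/eqP; rewrite -leqn0 leqNgt; apply/negP => mj.
have dj : deg j = ndeg pi (root_mnm i (val rho)).
  by rewrite root_mnm_ndeg; apply/eqP; rewrite -(W_mem j FW iF).
have e : U_(j)%MM = root_mnm i (val rho).
  apply: (ndeg_antichain dj); apply/mnm_lepP => l; rewrite mnm1E.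
  by case: eqVneq => // <-.
have ij : i != j by apply: contraTneq mj => <-; rewrite root_mnm_i.
have rE : val rho = mnm_row U_(j)%MM - mnm_row U_(i)%MM by rewrite e root_mnmE addrK.
apply: nss; exists j; rewrite rE; split.
- by rewrite opprB raddfB -!/(ndeg _ _) (W_ndeg FW iF jF) subrr.
- by rewrite !mxE !mnmE eqxx (negbTE ij).
- by move=> l nl; rewrite !mxE !mnmE [j == l]eq_sym (negbTE nl) sub0r opprK.
Qed.

(** Were $y_i/y^m$ a root at $j$, the sign conditions would give $y^m = y_j$; the degree then puts
    $j$ in $F$, whose variables do not occur in $y^m$. *)
Lemma root_outer F i m : F \in W pi -> i \in F -> outer_mnm (deg i) F m ->
  exists rho : nsroot pi i, root_mnm i (val rho) = m.
Proof.
move=> FW iF [dm m0]; pose rho := mnm_row m - mnm_row U_(i)%MM.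
suff nss : `[< nonss_root pi i rho >].
  exists (exist _ rho nss); apply: mnm_row_inj.
  by rewrite (root_mnmE (exist _ rho nss)) /= subrK.
apply/asboolP; split; first split.
- by rewrite raddfB -!/(ndeg _ _) dm subrr.
- by rewrite !mxE mnm1E eqxx m0.
- by move=> l nl; rewrite !mxE mnm1E eq_sym (negbTE nl) subr0.
case=> j [_ rj rge].
have mE l : rho 0 l = (m l)%:Z - (i == l)%:Z by rewrite !mxE mnm1E.
have ij : i != j by apply: contra_eqN rj => /eqP <-; rewrite mxE mE m0 // eqxx.
have e : m = U_(j)%MM.
  apply/mnmP => l; rewrite mnm1E; have [<-|nl] := eqVneq j l.
    by move: rj; rewrite mxE mE (negbTE ij) subr0 => /oppr_inj [].
  have [<-|nil] := eqVneq i l; first exact: m0.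
  have := rge l; rewrite eq_sym => /(_ nl); rewrite mxE mE (negbTE nil) subr0.
  by rewrite oppr_ge0; case: (m l).
have jF : j \in F by rewrite (W_mem j FW iF) -dm e.
by move: (m0 j jF); rewrite e mnm1E eqxx.
Qed.

End PointedGrading.

(** * Substitutions, and graded automorphisms as substitutions *)

Section Substitution.
Variable k : fieldType.

Lemma comp_mpolyU n r (lq : n.-tuple {mpoly k[r]}) i : 'X_i \mPo lq = tnth lq i.
Proof. by rewrite comp_mpolyXU -tnth_nth. Qed.

Lemma comp_mpoly_comp n l r (p : {mpoly k[n]}) (lp : n.-tuple {mpoly k[l]})
    (lq : l.-tuple {mpoly k[r]}) :
  (p \mPo lp) \mPo lq = p \mPo [tuple tnth lp i \mPo lq | i < n].
Proof.
rewrite !(comp_mpolyEX p) raddf_sum /=; apply: eq_bigr => m _.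
rewrite comp_mpolyZ !comp_mpolyX rmorph_prod; congr (_ *: _).
by apply: eq_bigr => i _; rewrite rmorphXn tnth_mktuple.
Qed.

Lemma eq_comp_mpoly n r (p : {mpoly k[n]}) (lp lq : n.-tuple {mpoly k[r]}) :
  {in msupp p, forall (m : 'X_{1..n}) i, m i != 0%N -> tnth lp i = tnth lq i} ->
  p \mPo lp = p \mPo lq.
Proof.
move=> h; rewrite (comp_mpolyEX p lp) (comp_mpolyEX p lq) [LHS]big_seq [RHS]big_seq.
apply: eq_bigr => m mp.
rewrite !comp_mpolyX; congr (_ *: _); apply: eq_bigr => i _.
by have [->|/(h _ mp) ->] := eqVneq (m i) 0%N; rewrite ?expr0.
Qed.

Lemma comp_mpoly_fix r (p : {mpoly k[r]}) (lq : r.-tuple {mpoly k[r]}) :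
  {in msupp p, forall (m : 'X_{1..r}) i, m i != 0%N -> tnth lq i = 'X_i} -> p \mPo lq = p.
Proof.
move=> h; rewrite -[RHS]comp_mpoly_id; apply: eq_comp_mpoly => m mp i mi.
by rewrite tnth_mktuple; exact: h mi.
Qed.

Variables (r : nat) (N : zmodType) (pi : {additive 'rV[int]_r -> N}).

Lemma graded_endoE f p : graded_endo (k := k) pi f ->
  f p = p \mPo [tuple f 'X_i | i < r].
Proof.
case=> fl [f1 fM] _.
have f0 : f 0 = 0 by have := fl (-1) 0 0; rewrite scaler0 addr0 scaleN1r addNr.
have fD : {morph f : x y / x + y} by move=> x y; have := fl 1 x y; rewrite !scale1r.
have fZ c x : f (c *: x) = c *: f x by have := fl c x 0; rewrite f0 !addr0.
have fX x n : f (x ^+ n) = f x ^+ n.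
  by elim: n => [|n IH]; rewrite ?expr0 // !exprS fM IH.
rewrite {1}(mpolyE p) comp_mpolyEX (big_morph f fD f0); apply: eq_bigr => m _.
rewrite fZ comp_mpolyX mpolyXE_id (big_morph f fM f1); congr (_ *: _).
by apply: eq_bigr => i _; rewrite fX tnth_mktuple.
Qed.

Lemma graut_eqX (a b : graut k pi) : (forall j, a 'X_j = b 'X_j) -> a = b.
Proof.
move=> e; apply: graut_ext => p.
rewrite (graded_endoE p (graut_endo a)) (graded_endoE p (graut_endo b)).
by apply: eq_comp_mpoly => m _ i _; rewrite !tnth_mktuple.
Qed.

End Substitution.

(** * The exponent of one variable as a grading *)

Section Exponent.
Variables (r : nat) (j : 'I_r).

(** Made into an additive map, so that [in_deg] and [comp_homog] apply to the exponent of $y_j$ as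
    they do to [pi]. *)
Definition row_entry (n : 'rV[int]_r) : int := n 0 j.

Fact row_entry_additive : {morph row_entry : x y / x - y}.
Proof. by move=> x y; rewrite /row_entry !mxE. Qed.
HB.instance Definition _ :=
  GRing.isZmodMorphism.Build 'rV[int]_r int row_entry row_entry_additive.

Lemma ndeg_row_entry m : ndeg row_entry m = (m j)%:Z.
Proof. by rewrite /ndeg /= /row_entry mxE. Qed.

End Exponent.

(** * The root spaces as spaces of polynomials avoiding a class *)

Section OuterPolynomials.
Variables (k : fieldType) (r : nat) (N : zmodType).
Variable pi : {additive 'rV[int]_r -> N}.
Hypothesis pointed : forall n, pi n = 0 -> (forall j, 0 <= n 0 j) -> n = 0.
Implicit Types (i j : 'I_r) (m : 'X_{1..r}) (F : {set 'I_r}) (p : {mpoly k[r]}).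
Local Notation deg i := (ndeg pi U_(i)%MM).

(* Not involving y_j is the same as being homogeneous of degree 0 for the grading
   by the exponent of y_j. *)
Definition outer_poly c F p :=
  in_deg pi c p /\ forall j, j \in F -> in_deg (row_entry j) 0 p.

Lemma outer_polyP c F p :
  outer_poly c F p <-> {in msupp p, forall m, outer_mnm pi c F m}.
Proof.
split=> [[pc p0] m mp|h].
  by split=> [|j jF]; [exact: pc | have := p0 j jF m mp; rewrite ndeg_row_entry => -[]].
by split=> [m /h[]//|j jF m /h[_ m0]]; rewrite ndeg_row_entry m0.
Qed.

Lemma outer_polyX c F m : outer_mnm pi c F m -> outer_poly c F 'X_[m].
Proof. by move=> h; apply/outer_polyP => m'; rewrite msuppX inE => /eqP ->. Qed.

Lemma outer_polyZ c F a p : outer_poly c F p -> outer_poly c F (a *: p).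
Proof. by move=> [pc p0]; split=> [|j jF]; apply: in_degZ => //; exact: p0. Qed.

Lemma outer_poly_sum c F (I : Type) (s : seq I) (P : pred I) (f : I -> {mpoly k[r]}) :
  (forall x, P x -> outer_poly c F (f x)) -> outer_poly c F (\sum_(x <- s | P x) f x).
Proof.
move=> h; split=> [|j jF]; apply: in_deg_sum => x /h[] // _; exact.
Qed.

Lemma outer_poly_fix c F p (lq : r.-tuple {mpoly k[r]}) : outer_poly c F p ->
  (forall j, j \notin F -> tnth lq j = 'X_j) -> p \mPo lq = p.
Proof.
move=> /outer_polyP h e; apply: comp_mpoly_fix => m /h[_ m0] j mj; apply: e.
by apply: contra mj => /m0 ->.
Qed.

Lemma root_polyZ i (a : k) (t : Vi k pi i) : root_poly (a *: t) = a *: root_poly t.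
Proof.
(* The support of [a *: t] may be smaller than that of [t], so its sum is extended to the support of
   [t]. *)
rewrite !root_polyE (monalg.mmapEw (monalg.msuppZ_le _ _)) monalg.mmapE scaler_sumr.
by apply: eq_bigr => rho _; rewrite monalg.mcoeffZ /= mpolyCM -mulrA mul_mpolyC.
Qed.

Fact root_poly_linear i : linear (@root_poly k r N pi i).
Proof. by move=> a t u; rewrite root_polyD root_polyZ. Qed.
HB.instance Definition _ i := GRing.isLinear.Build k (Vi k pi i) {mpoly k[r]} _
  (@root_poly k r N pi i) (@root_poly_linear i).

Lemma tauX i (t : Vi k pi i) j :
  tau t 'X_j = 'X_j + (if j == i then root_poly t else 0).
Proof. by rewrite /= comp_mpolyU tnth_mktuple. Qed.

Lemma root_poly_inj i : injective (@root_poly k r N pi i).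
Proof. by move=> t u e; apply/tau_inj/graut_eqX => j; rewrite !tauX e. Qed.

Lemma root_poly_outer F i (t : Vi k pi i) : F \in W pi -> i \in F ->
  outer_poly (deg i) F (root_poly t).
Proof.
move=> FW iF; apply: outer_poly_sum => rho _.
by apply/outer_polyZ/outer_polyX/outer_root.
Qed.

Lemma root_poly_onto F i p : F \in W pi -> i \in F ->
  outer_poly (deg i) F p -> exists t : Vi k pi i, root_poly t = p.
Proof.
move=> FW iF /outer_polyP h; rewrite (mpolyE p).
(* The induction runs over lists of monomials; the membership test keeps each of them within reach
   of [h]. *)
have: all (mem (msupp p)) (msupp p) by apply/allP.
elim: {-1}(msupp p) => [|m s IH]; first by exists 0; rewrite big_nil raddf0.
move=> /= /andP[mp /IH [t tE]]; have [rho rhoE] := root_outer FW iF (h m mp).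
exists (p@_m *: monalg.mkmalgU rho 1 + t).
rewrite big_cons root_polyD root_polyZ tE; congr (_ *: _ + _).
by rewrite root_polyE monalg.mmapU /= mpolyC1 mul1r rhoE.
Qed.

Lemma tau_fix F i (t : Vi k pi i) c p : i \in F -> outer_poly c F p -> tau t p = p.
Proof.
move=> iF po; apply: (outer_poly_fix po) => j jF; rewrite tnth_mktuple.
by case: eqP jF => [->|]; rewrite ?iF ?addr0.
Qed.

(** The polynomials added by the factors avoid all variables of $F$, hence are fixed by every
    factor, and the contributions simply add up. *)
Lemma tauFX F (t : VF k pi F) j : F \in W pi ->
  tauF t 'X_j = 'X_j + \sum_(x : {i | i \in F} | val x == j) root_poly (t x).
Proof.
move=> FW; rewrite /tauF; elim: (index_enum _) => [|x s IH].
  by rewrite !big_nil addr0.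
rewrite !big_cons grautM IH (comp_mpolyD _ _ _ : tau _ (_ + _) = tau _ _ + tau _ _).
rewrite tauX (@tau_fix F (val x) (t x) (deg j) _ (valP x)); last first.
  by apply: outer_poly_sum => y /eqP <-; apply: root_poly_outer => //; exact: valP.
by rewrite eq_sym; case: eqP => _; rewrite ?addrA ?addr0.
Qed.

Lemma tauFX_in F (t : VF k pi F) (x : {i | i \in F}) : F \in W pi ->
  tauF t 'X_(val x) = 'X_(val x) + root_poly (t x).
Proof. by move=> FW; rewrite tauFX // (big_pred1 x) // => y; rewrite val_eqE. Qed.

Lemma tauFX_out F (t : VF k pi F) j : F \in W pi -> j \notin F ->
  tauF t 'X_j = 'X_j.
Proof.
move=> FW jF; rewrite tauFX // big_pred0 ?addr0 // => x.
by apply: contraNF jF => /eqP <-; exact: valP.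
Qed.

(** Replacing the variables of $F$ by linear forms in them keeps the exponent of each variable
    outside $F$, in particular of those of $F'$. *)
Lemma gl_aut_outer F F' (FW : F \in W pi) (g : GL k #|F|) c p :
  F' \in W pi -> F != F' -> outer_poly c F' p -> outer_poly c F' (gl_aut FW g p).
Proof.
move=> FW' nF [pc p0]; split=> [|j jF'].
  by case: (graut_endo (gl_aut FW g)) => _ _; exact.
apply: comp_homog (p0 j jF') => l.
have jF : j \notin F by apply: (W_notin FW' FW) jF'; rewrite eq_sym.
have [lF|lF] := boolP (l \in F); last by rewrite gl_tuple_out //; exact: in_degX.
rewrite -(enum_rankK_in lF lF) gl_tuple_in; apply: in_deg_sum => a _; apply: in_degZ.
have U0 b : b \in F -> ndeg (row_entry j) U_(b)%MM = 0.
  by move=> bF; rewrite ndeg_row_entry mnm1E; case: eqP jF => // <-; rewrite bF.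
by move=> m; rewrite msuppX inE => /eqP ->; rewrite !U0 ?enum_valP.
Qed.

End OuterPolynomials.

(** * Transport of representations along injective linear maps *)

Section Transport.
Variables (k : fieldType) (G : groupType) (A : lmodType k) (act0 : G -> A -> A).

Lemma lift_rep (V : lmodType k) (L : {linear V -> A}) :
    injective L -> is_rep act0 ->
    (forall g t, exists t', L t' = act0 g (L t)) ->
  exists2 act, is_rep act & forall g t, L (act g t) = act0 g (L t).
Proof.
move=> Linj [lin0 one0 mul0] stable.
(* The default 0 is never taken, as [stable] provides a preimage. *)
pose act g t := xget 0 [set t' | L t' = act0 g (L t)]%classic.
have actE g t : L (act g t) = act0 g (L t).
  by rewrite /act; exact: (xgetPex 0 (stable g t)).
exists act => //; split=> [g a x y|x|g h x]; apply: Linj.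
- by rewrite linearP !actE linearP lin0.
- by rewrite actE one0.
- by rewrite /= !actE mul0.
Qed.

(** Both spaces are identified with one common image in [A], so that isomorphisms reduce to
    comparing spaces of polynomials. *)
Lemma rep_iso_image (V V' : lmodType k) (L : {linear V -> A}) (L' : {linear V' -> A})
    (act : G -> V -> V) (act' : G -> V' -> V') :
    injective L -> injective L' ->
    (forall x, exists y, L' y = L x) -> (forall y, exists x, L x = L' y) ->
    (forall g x, L (act g x) = act0 g (L x)) ->
    (forall g y, L' (act' g y) = act0 g (L' y)) ->
  rep_iso act act'.
Proof.
move=> Li Li' /choice[f fE] /choice[h hE] aE aE'.
have flin : linear f by move=> a x y; apply: Li'; rewrite linearP !fE linearP.
pose F := HB.pack_for {linear V -> V'} f (GRing.isLinear.Build k V V' _ f flin).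
exists F => [|g x]; last by apply: Li'; rewrite /= fE aE aE' fE.
exists h => [x|y]; [apply: Li | apply: Li']; by rewrite /= ?hE fE ?hE.
Qed.

(** The relation is put without inverses so that both sides can be evaluated on the variables. *)
Lemma conj_rep_comm (H : groupType) (iota : G -> H) (V : lmodType k)
    (exp : V -> H) (act : G -> V -> V) : is_rep act ->
    (forall g x, exp (act g x) * iota g = iota g * exp x)%g ->
  conj_rep iota exp act.
Proof. by move=> rep h; split=> // g x; rewrite -h mulgK. Qed.

End Transport.

(** * Linearity of graded automorphisms *)

Section GrautLinear.
Variables (k : fieldType) (r : nat) (N : zmodType).
Variables (pi : {additive 'rV[int]_r -> N}) (a : graut k pi).

Lemma graut_linear : linear a.
Proof. by case: (graut_endo a). Qed.

Lemma grautD : {morph a : p q / p + q}.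
Proof. by move=> p q; have := graut_linear 1 p q; rewrite !scale1r. Qed.

Lemma graut0 : a 0 = 0.
Proof. by apply: (addrI (a 0)); rewrite -grautD !addr0. Qed.

Lemma grautZ c p : a (c *: p) = c *: a p.
Proof. by have := graut_linear c p 0; rewrite graut0 !addr0. Qed.

Lemma graut_sum (I : Type) (s : seq I) (P : pred I) f :
  a (\sum_(i <- s | P i) f i) = \sum_(i <- s | P i) a (f i).
Proof. exact: (big_morph a grautD graut0). Qed.

End GrautLinear.

(** * Conjugation by $Gl_F$ *)

Section GroupActions.
Variables (k : fieldType) (r : nat) (N : zmodType).
Variable pi : {additive 'rV[int]_r -> N}.
Hypothesis pointed : forall n, pi n = 0 -> (forall j, 0 <= n 0 j) -> n = 0.
Variables (F : {set 'I_r}) (FW : F \in W pi).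
Implicit Types (i j : 'I_r) (m : 'X_{1..r}) (g : GL k #|F|) (p : {mpoly k[r]}).
Local Notation deg i := (ndeg pi U_(i)%MM).

Lemma gl_aut1 : gl_aut FW (1%g : GL k #|F|) = 1%g.
Proof.
by apply: (mulgI (gl_aut FW 1%g)); rewrite -(gl_autM FW 1%g 1%g) !mulg1.
Qed.

Lemma gl_aut_rep : is_rep (fun g => gl_aut FW g : {mpoly k[r]} -> {mpoly k[r]}).
Proof.
split=> [g|p|g h p]; first exact: graut_linear.
- by rewrite gl_aut1.
- by rewrite gl_autM.
Qed.

Lemma gl_aut_fix g c p : outer_poly pi c F p -> gl_aut FW g p = p.
Proof. by move=> po; apply: (outer_poly_fix po) => j jF; exact: gl_tuple_out. Qed.

Lemma mem_enum_rank (P : 'I_r -> Prop) :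
  (forall b : 'I_#|F|, P (enum_val b)) -> (forall j, j \notin F -> P j) ->
  forall j, P j.
Proof.
move=> hin hout j; have [jF|] := boolP (j \in F); last exact: hout.
by rewrite -(enum_rankK_in jF jF).
Qed.

Definition Fidx (b : 'I_#|F|) : {i | i \in F} := exist _ (enum_val b) (enum_valP b).

Lemma FidxP (x : {i | i \in F}) : exists b, x = Fidx b.
Proof.
case: x => i iF; exists (enum_rank_in iF i); apply: val_inj => /=.
by rewrite enum_rankK_in.
Qed.

(** * The action on $V_F$ *)

Section SameClass.

Definition VF_polys (t : VF k pi F) : {ffun 'I_#|F| -> {mpoly k[r]}} :=
  [ffun b => root_poly (t (Fidx b))].

Fact VF_polys_linear : linear VF_polys.
Proof. by move=> a t u; apply/ffunP => b; rewrite !ffunE root_polyD root_polyZ. Qed.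
HB.instance Definition _ := GRing.isLinear.Build k (VF k pi F)
  {ffun 'I_#|F| -> {mpoly k[r]}} _ VF_polys VF_polys_linear.

(** The row [u] times the inverse of [g]: the action on $E_F^* \otimes A_C$ that is trivial on the
    second factor. *)
Definition ffun_dual_act g (u : {ffun 'I_#|F| -> {mpoly k[r]}}) :
    {ffun 'I_#|F| -> {mpoly k[r]}} :=
  [ffun b => \sum_a invmx g a b *: u a].

Lemma ffun_dual_rep : is_rep ffun_dual_act.
Proof.
split=> [g a u w|u|g h u]; apply/ffunP => b; rewrite !ffunE.
- rewrite scaler_sumr -big_split; apply: eq_bigr => c _ /=.
  by rewrite !ffunE scalerDr !scalerA mulrC.
- rewrite invmx1 (bigD1 b) //= big1 => [|c nc]; rewrite mxE.
    by rewrite eqxx scale1r addr0.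
  by rewrite (negbTE nc) scale0r.
- rewrite /= (congr1 (@GLmx k _) (invgM g h) : invmx (g *m h) = invmx h *m invmx g).
  under [RHS]eq_bigr => a _ do rewrite ffunE scaler_sumr.
  rewrite exchange_big /=; apply: eq_bigr => a _; rewrite mxE scaler_suml.
  by apply: eq_bigr => c _; rewrite scalerA mulrC.
Qed.

Lemma VF_polys_inj : injective VF_polys.
Proof.
move=> t u /ffunP e; apply/ffunP => x; have [b ->] := FidxP x.
by apply: root_poly_inj; have := e b; rewrite !ffunE.
Qed.

Lemma VF_polys_outer (t : VF k pi F) b i : i \in F -> outer_poly pi (deg i) F (VF_polys t b).
Proof.
move=> iF; rewrite ffunE (W_ndeg FW iF (enum_valP b)).
exact: root_poly_outer (enum_valP b).
Qed.

Lemma VF_polys_onto (u : {ffun 'I_#|F| -> {mpoly k[r]}}) i : i \in F ->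
  (forall b, outer_poly pi (deg i) F (u b)) ->
  exists t : VF k pi F, VF_polys t = u.
Proof.
move=> iF uo; pose b (x : {i | i \in F}) := enum_rank_in (valP x) (val x).
have H (x : {i | i \in F}) : exists t : Vi k pi (val x), root_poly t = u (b x).
  by apply: (root_poly_onto FW (valP x)); rewrite -(W_ndeg FW iF (valP x)).
exists [ffun x => sval (cid (H x))]; apply/ffunP => c; rewrite !ffunE.
by rewrite (svalP (cid (H (Fidx c)))) /b enum_valK_in.
Qed.

Lemma VF_polys_stable g (t : VF k pi F) : exists t', VF_polys t' = ffun_dual_act g (VF_polys t).
Proof.
have [i iF] := W_neq0 FW; apply: (VF_polys_onto iF) => b; rewrite ffunE.
by apply: outer_poly_sum => a _; apply/outer_polyZ/VF_polys_outer.
Qed.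

Lemma tauFX_enum (t : VF k pi F) b :
  tauF t 'X_(enum_val b) = 'X_(enum_val b) + VF_polys t b.
Proof. by rewrite ffunE -(tauFX_in pointed t (Fidx b) FW). Qed.

(** On $y_b$ the two sides are $\sum_a g_{ab}(y_a + p'_a)$ and $\sum_a g_{ab} y_a + p_b$, since $g$
    fixes $p_b$, which avoids $F$. They agree because $p' = p g^{-1}$. *)
Lemma conj_tauF g (t t' : VF k pi F) : VF_polys t' = ffun_dual_act g (VF_polys t) ->
  (tauF t' * gl_aut FW g = gl_aut FW g * tauF t)%g.
Proof.
move=> tE; apply: graut_eqX; apply: mem_enum_rank => [b|j jF]; last first.
  by rewrite !grautM gl_aut_out // !(tauFX_out pointed) // gl_aut_out.
have [i iF] := W_neq0 FW.
rewrite !grautM gl_aut_in tauFX_enum grautD gl_aut_in.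
rewrite (gl_aut_fix g (VF_polys_outer t b iF)) graut_sum.
rewrite (eq_bigr (fun a => GLmx g a b *: 'X_(enum_val a) +
    GLmx g a b *: VF_polys t' a)) => [|a _]; last by rewrite grautZ tauFX_enum scalerDr.
rewrite big_split /=; congr (_ + _); rewrite tE.
under eq_bigr => a _ do rewrite ffunE scaler_sumr.
(* The coefficient of $p_c$ is the entry $(c,b)$ of $g^{-1} g$. *)
rewrite exchange_big /= (bigD1 b) //= [X in _ + X]big1 => [|c nc].
  under eq_bigr => a _ do rewrite scalerA mulrC.
  rewrite -scaler_suml addr0 -[RHS]scale1r; congr (_ *: _).
  by have /matrixP/(_ b b) := mulVmx (GLmx_unit g); rewrite !mxE eqxx.
under eq_bigr => a _ do rewrite scalerA mulrC.
rewrite -scaler_suml -[RHS](scale0r (VF_polys t c)); congr (_ *: _).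
by have /matrixP/(_ c b) := mulVmx (GLmx_unit g); rewrite !mxE (negbTE nc).
Qed.

Lemma rep_VF : exists2 act : GL k #|F| -> VF k pi F -> VF k pi F,
    conj_rep (gl_aut FW) (@tauF k r N pi F) act
  & exists s : nat, rep_iso act
      (dprod_act (V := fun _ : 'I_s => 'rV[k]_#|F|) (fun _ => @dual_act k #|F|)).
Proof.
have [act rep actE] := lift_rep VF_polys_inj ffun_dual_rep VF_polys_stable.
exists act; first by apply: conj_rep_comm => // g t; exact: conj_tauF.
(* There is one copy of $E_F^*$ for each monomial that has the degree of the class and avoids
   $F$. *)
have [i iF] := W_neq0 FW; have [s us sP] := outer_mnm_seq pointed (deg i) F.
exists (size s).
pose f (x : dprod (fun _ : 'I_(size s) => 'rV[k]_#|F|)) : {ffun 'I_#|F| -> {mpoly k[r]}} :=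
  [ffun b => \sum_l x l 0 b *: 'X_[tnth (in_tuple s) l]].
have flin : linear f.
  move=> a x y; apply/ffunP => b; rewrite !ffunE scaler_sumr -big_split.
  by apply: eq_bigr => l _; rewrite !ffunE !mxE scalerDl scalerA.
pose L := HB.pack_for {linear _ -> _} f (GRing.isLinear.Build k _ _ _ f flin).
have sinj : injective (tnth (in_tuple s)) by apply/tuple_uniqP.
have coef x b l : (f x b)@_(tnth (in_tuple s) l) = x l 0 b.
  rewrite ffunE raddf_sum (bigD1 l) //= big1 => [|l' nl].
    by rewrite mcoeffZ mcoeffX eqxx mulr1 addr0.
  by rewrite mcoeffZ mcoeffX (inj_eq sinj) (negbTE nl) mulr0.
apply: (rep_iso_image (L := VF_polys) (L' := L) VF_polys_inj _ _ _ actE).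
- move=> x y e; apply/ffunP => l; apply/rowP => b.
  by rewrite -!coef; congr (_@__); have := congr1 (fun h => fun_of_fin h b) e.
(* The row attached to a monomial collects its coefficients in the polynomials of the family. *)
- move=> t; pose x : dprod (fun _ : 'I_(size s) => 'rV[k]_#|F|) :=
    [ffun l => \row_b (VF_polys t b)@_(tnth (in_tuple s) l)].
  exists x; apply/ffunP => b; apply/mpolyP => m.
  have [/seq_tnthP[l ->]|ms] := boolP (m \in s); first by rewrite coef ffunE mxE.
  have out p : outer_poly pi (deg i) F p -> p@_m = 0.
    move=> /outer_polyP po; apply: memN_msupp_eq0; apply: contra ms => /po.
    by move/sP.
  rewrite !out //; first exact: VF_polys_outer.
  rewrite ffunE; apply: outer_poly_sum => l _; apply/outer_polyZ/outer_polyX/sP.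
  exact: mem_tnth.
- move=> x; apply: (VF_polys_onto iF) => b; rewrite ffunE.
  apply: outer_poly_sum => l _; apply/outer_polyZ/outer_polyX/sP; exact: mem_tnth.
- move=> g x; apply/ffunP => b; rewrite !ffunE.
  under [RHS]eq_bigr => a _ do rewrite ffunE scaler_sumr.
  rewrite exchange_big; apply: eq_bigr => l _ /=; rewrite ffunE mxE scaler_suml.
  by apply: eq_bigr => a _; rewrite scalerA mulrC.
Qed.

End SameClass.

(** * The action on a root space of another class *)

Section DifferentClass.
Variables (F' : {set 'I_r}) (FW' : F' \in W pi) (nFF' : F != F').
Variables (i : 'I_r) (iF' : i \in F').

Lemma Vi_stable g (t : Vi k pi i) :
  exists t' : Vi k pi i, root_poly t' = gl_aut FW g (root_poly t).
Proof.
by apply: (root_poly_onto FW' iF'); apply: gl_aut_outer => //; exact: root_poly_outer.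
Qed.

(** Since $g$ moves only variables of $F$ and [tau t] only $y_i$, with $i$ outside $F$, only $y_i$
    needs care; there both sides are $y_i + g(p)$, with $p$ the polynomial of [t]. *)
Lemma conj_tau g (t t' : Vi k pi i) : root_poly t' = gl_aut FW g (root_poly t) ->
  (tau t' * gl_aut FW g = gl_aut FW g * tau t)%g.
Proof.
move=> tE; have iF : i \notin F by apply: (W_notin FW' FW) iF'; rewrite eq_sym.
have ni (b : 'I_#|F|) : (enum_val b == i) = false.
  by apply: contraNF iF => /eqP <-; exact: enum_valP.
apply: graut_eqX; apply: mem_enum_rank => [b|j jF]; rewrite !grautM tauX.
  rewrite ni addr0 (gl_aut_in FW g b) (graut_sum (tau t')); apply: eq_bigr => a _.
  by rewrite (grautZ (tau t')) tauX ni addr0.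
rewrite (grautD (gl_aut FW g)) (gl_aut_out FW g jF) tauX tE.
by case: eqP => // _; rewrite (graut0 (gl_aut FW g)).
Qed.

Lemma rep_Vi : exists2 act : GL k #|F| -> Vi k pi i -> Vi k pi i,
    conj_rep (gl_aut FW) (@tau k r N pi i) act
  & forall g t, root_poly (act g t) = gl_aut FW g (root_poly t).
Proof.
have [act rep actE] := lift_rep (@root_poly_inj _ _ _ _ i) gl_aut_rep Vi_stable.
by exists act => //; apply: conj_rep_comm => // g t; apply: conj_tau; exact: actE.
Qed.

(** For $j$ in $F$ the sum has a single term, the entry of [n] at the rank of $j$. Thus
    [merge_mnm m 0] is the part of [m] outside $F$. *)
Definition merge_mnm m (n : 'X_{1..#|F|}) : 'X_{1..r} :=
  [multinom if j \in F then \sum_(b | enum_val b == j) n b else m j | j < r]%N.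

Definition restrict_mnm m : 'X_{1..#|F|} := [multinom m (enum_val b) | b < #|F|].

Lemma merge_in m n b : merge_mnm m n (enum_val b) = n b.
Proof.
rewrite mnmE enum_valP (big_pred1 b) // => a; exact: (inj_eq enum_val_inj).
Qed.

Lemma merge_out m n j : j \notin F -> merge_mnm m n j = m j.
Proof. by rewrite mnmE => /negbTE ->. Qed.

Lemma eq_mnm_rank m m' : (forall b : 'I_#|F|, m (enum_val b) = m' (enum_val b)) ->
  (forall j, j \notin F -> m j = m' j) -> m = m'.
Proof. by move=> h h'; apply/mnmP; exact: mem_enum_rank. Qed.

Lemma merge_restrict m : merge_mnm m (restrict_mnm m) = m.
Proof.
by apply: eq_mnm_rank => [b|j jF]; rewrite ?merge_in ?merge_out // mnmE.
Qed.

Lemma restrict_merge m n : restrict_mnm (merge_mnm m n) = n.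
Proof. by apply/mnmP => b; rewrite mnmE merge_in. Qed.

Lemma merge_merge m n n' : merge_mnm (merge_mnm m n) n' = merge_mnm m n'.
Proof. by apply: eq_mnm_rank => [b|j jF]; rewrite ?merge_in ?merge_out. Qed.

Lemma mergeD m n : merge_mnm m n =
  (merge_mnm m 0 + \sum_b U_(enum_val b) *+ n b)%MM.
Proof.
apply: eq_mnm_rank => [b|j jF]; rewrite mnmDE mnm_sumE ?merge_in ?merge_out //.
  rewrite (bigD1 b) //= mulmnE !mnmE eqxx mul1n big1 ?addn0 // => a na.
  by rewrite mulmnE mnmE (inj_eq enum_val_inj) (negbTE na).
rewrite big1 ?addn0 // => b _; rewrite mulmnE mnmE.
by case: eqP jF => // <-; rewrite enum_valP.
Qed.

Lemma merge_eq m m' n n' : (merge_mnm m n == merge_mnm m' n') =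
  (merge_mnm m 0 == merge_mnm m' 0) && (n == n').
Proof.
apply/eqP/andP => [e|[/eqP e /eqP <-]]; last by rewrite mergeD e -mergeD.
split; apply/eqP; first by rewrite -(merge_merge m n) e merge_merge.
by apply/mnmP => b; rewrite -(merge_in m) e merge_in.
Qed.

(** All variables of $F$ have one degree, so the part of a monomial in them counts only through its
    total degree. *)
Lemma ndeg_merge m n j : j \in F ->
  ndeg pi (merge_mnm m n) = ndeg pi (merge_mnm m 0) + deg j *+ mdeg n.
Proof.
move=> jF; rewrite mergeD ndegD; congr (_ + _); rewrite mdegE -sumrMnr.
rewrite (big_morph (ndeg pi) (id1 := 0) (op1 := +%R)); last first.
- by rewrite /ndeg -[RHS](raddf0 pi); congr (pi _); apply/rowP => l; rewrite !mxE mnm0E.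
- exact: ndegD.
apply: eq_bigr => b _; rewrite (W_ndeg FW jF (enum_valP b)) /ndeg -raddfMn.
congr (pi _); apply/rowP => l; rewrite mulmxnE !mxE mulmnE PoszM.
by rewrite -mulr_natr natz.
Qed.

Definition F_vars : #|F|.-tuple {mpoly k[r]} := [tuple 'X_(enum_val b) | b < #|F|].

Lemma merge_mpoly m (p : {mpoly k[#|F|]}) : 'X_[merge_mnm m 0] * (p \mPo F_vars) =
  \sum_(n <- msupp p) p@_n *: 'X_[merge_mnm m n].
Proof.
rewrite comp_mpolyEX mulr_sumr; apply: eq_bigr => n _.
rewrite -scalerAr (mergeD m n) mpolyXD comp_mpolyX; congr (_ *: (_ * _)).
rewrite (big_morph _ (@mpolyXD r k) (@mpolyX0 r k)).
by apply: eq_bigr => b _; rewrite tnth_mktuple mpolyXn.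
Qed.

(** A monomial splits uniquely into its parts outside and inside $F$, so products with different
    outside parts share no monomial. *)
Lemma mcoeff_merge m m' n (p : {mpoly k[#|F|]}) :
  ('X_[merge_mnm m 0] * (p \mPo F_vars))@_(merge_mnm m' n) =
  if merge_mnm m 0 == merge_mnm m' 0 then p@_n else 0.
Proof.
rewrite merge_mpoly raddf_sum /=; under eq_bigr do rewrite mcoeffZ mcoeffX merge_eq.
case: ifP => _; last by rewrite big1 // => n' _; rewrite mulr0.
by rewrite [in RHS](mpolyE p) raddf_sum /=; apply: eq_bigr => n' _; rewrite mcoeffZ mcoeffX.
Qed.

Lemma gl_aut_vars g (p : {mpoly k[#|F|]}) :
  gl_aut FW g (p \mPo F_vars) = (p \mPo lin_forms g) \mPo F_vars.
Proof.
rewrite /= !comp_mpoly_comp; apply: eq_comp_mpoly => n _ b _; rewrite !tnth_mktuple.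
rewrite comp_mpolyU gl_tuple_in raddf_sum; apply: eq_bigr => a _ /=.
by rewrite comp_mpolyZ comp_mpolyU tnth_mktuple.
Qed.

Lemma gl_aut_merge0 g m : gl_aut FW g 'X_[merge_mnm m 0] = 'X_[merge_mnm m 0].
Proof.
apply: comp_mpoly_fix => m'; rewrite msuppX inE => /eqP -> j mj.
apply: gl_tuple_out; apply: contraNN mj => jF.
by rewrite -(enum_rankK_in jF jF) merge_in mnm0E.
Qed.

(* The summands are indexed by the monomials, among those of the root vectors, in
   which y_j0 is the only variable of F that occurs, for a fixed j0 in F; the
   degree of the summand is the exponent of y_j0. *)
Lemma rep_Vi_sym (act : GL k #|F| -> Vi k pi i -> Vi k pi i) :
    (forall g t, root_poly (act g t) = gl_aut FW g (root_poly t)) ->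
  exists (s : nat) (e : 'I_s -> nat),
    rep_iso act (dprod_act (V := fun l => dhomog #|F| k (e l))
                           (fun l => @sym_act k #|F| (e l))).
Proof.
move=> actE; have [j0 j0F] := W_neq0 FW; pose b0 := enum_rank_in j0F j0.
have [s' us' sP'] := outer_mnm_seq pointed (deg i) F'.
(* Collapsing concentrates the part of [m] in $F$ on $y_{j_0}$; it gives one representative to all
   monomials with the same part outside $F$ and the same degree inside $F$. *)
pose collapse m := merge_mnm m (U_(b0) *+ mdeg (restrict_mnm m))%MM.
pose s := [seq m <- s' | collapse m == m].
have us : uniq s by rewrite filter_uniq.
have ml_uniq m m' : collapse m = m -> collapse m' = m' ->
    merge_mnm m 0 = merge_mnm m' 0 ->
    mdeg (restrict_mnm m) = mdeg (restrict_mnm m') -> m = m'.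
  by move=> c c' e0 ed; apply/eqP; rewrite -c -c' /collapse merge_eq e0 ed !eqxx.
have outerP m n : outer_mnm pi (deg i) F' m -> mdeg n = mdeg (restrict_mnm m) ->
    outer_mnm pi (deg i) F' (merge_mnm m n).
  move=> [dm m0] e; split=> [|j jF'].
    by rewrite (ndeg_merge _ _ j0F) e -(ndeg_merge _ _ j0F) merge_restrict.
  by rewrite merge_out ?m0 //; apply: (W_notin FW' FW) jF'; rewrite eq_sym.
have mdegU n : mdeg (U_(b0) *+ n)%MM = n by rewrite mdegMn mdeg1 mul1n.
have collapse_s m : outer_mnm pi (deg i) F' m -> collapse m \in s.
  move=> h; rewrite mem_filter; apply/andP; split; last by apply/sP'/outerP.
  by rewrite {1}/collapse merge_merge restrict_merge mdegU.
pose ml := tnth (in_tuple s).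
have mlP l : collapse (ml l) = ml l /\ outer_mnm pi (deg i) F' (ml l).
  by have := mem_tnth l (in_tuple s); rewrite mem_filter => /andP[/eqP -> /sP'].
have ml_inj : injective ml by apply/tuple_uniqP.
pose e l := mdeg (restrict_mnm (ml l)).
exists (size s), e.
pose V l := dhomog #|F| k (e l).
pose f (x : dprod V) : {mpoly k[r]} :=
  \sum_l 'X_[merge_mnm (ml l) 0] * ((x l : {mpoly k[#|F|]}) \mPo F_vars).
have flin : linear f.
  move=> a x y; rewrite /f scaler_sumr -big_split; apply: eq_bigr => l _ /=.
  by rewrite !ffunE /= linearP /= mulrDr scalerAr.
pose L := HB.pack_for {linear _ -> _} f (GRing.isLinear.Build k _ _ _ f flin).
have coef0 (x : dprod V) l n : mdeg n != e l -> (x l : {mpoly k[#|F|]})@_n = 0.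
  by apply: dhomog_nemf_coeff; exact: dhomog_is_dhomog.
have coef x l n : mdeg n = e l -> (f x)@_(merge_mnm (ml l) n) = (x l : {mpoly k[#|F|]})@_n.
  move=> nl; rewrite raddf_sum (bigD1 l) //= mcoeff_merge eqxx big1 ?addr0 // => l' nl'.
  (* Another summand with the same part outside $F$ has a different degree, as the two data together
     determine the index. *)
  rewrite mcoeff_merge; case: eqP => // e0; apply: coef0; apply: contraNneq nl' => e1.
  have [[c _] [c' _]] := (mlP l, mlP l').
  by apply/eqP/ml_inj/ml_uniq => //; rewrite -[RHS]nl e1.
have f_outer x : outer_poly pi (deg i) F' (f x).
  apply: outer_poly_sum => l _; rewrite merge_mpoly big_seq.
  apply: outer_poly_sum => n nx; apply/outer_polyZ/outer_polyX/outerP.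
    by have [] := mlP l.
  by apply/eqP; apply: contraTT nx => /coef0; rewrite -mcoeff_eq0 => ->.
apply: (rep_iso_image (act0 := fun g => gl_aut FW g : {mpoly k[r]} -> {mpoly k[r]})
   (L := @root_poly k r N pi i) (L' := L) (@root_poly_inj _ _ _ _ i) _ _ _ actE).
- move=> x y exy; apply/ffunP => l; apply/val_inj/mpolyP => n /=.
  have [nl|nl] := eqVneq (mdeg n) (e l); last by rewrite !coef0.
  by rewrite -(coef x l n nl) -(coef y l n nl); congr (_@__).
- move=> t; pose p := root_poly t; have /outer_polyP po := root_poly_outer pointed t FW' iF'.
  (* The terms of [p] whose monomials collapse to [ml l] share their part outside $F$; [q l] is
     their sum divided by it. *)
  pose q l := \sum_(m <- msupp p | collapse m == ml l) p@_m *: 'X_[restrict_mnm m].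
  have qh l : q l \is (e l).-homog.
    apply: rpred_sum => m /eqP cm; apply: rpredZ.
    by rewrite dhomogX /= /e -cm restrict_merge mdegU.
  pose x : dprod V := [ffun l => DHomog (qh l)].
  exists x; rewrite /= -/p [RHS]mpolyE /f.
  under eq_bigr => l _ do rewrite ffunE /= raddf_sum mulr_sumr /=.
  rewrite (exchange_big_dep predT) //= [LHS]big_seq [RHS]big_seq; apply: eq_bigr => m mp.
  have /seq_tnthP[l lE] := collapse_s _ (po _ mp).
  rewrite (big_pred1 l) => [|l']; last by rewrite lE (inj_eq ml_inj) eq_sym.
  rewrite comp_mpolyZ -scalerAr; congr (_ *: _).
  have := merge_mpoly (ml l) 'X_[restrict_mnm m]; rewrite msuppX big_seq1 mcoeffX eqxx.
  by rewrite scale1r => ->; rewrite -[ml l]lE merge_merge merge_restrict.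
- by move=> x; exact: root_poly_onto (f_outer x).
- move=> g x; rewrite -[RHS]/(gl_aut FW g (f x)) -[LHS]/(f _) /f.
  have [_ [_ gM] _] := graut_endo (gl_aut FW g).
  rewrite (graut_sum (gl_aut FW g)); apply: eq_bigr => l _.
  by rewrite ffunE gM gl_aut_merge0 gl_aut_vars.
Qed.

End DifferentClass.

(** * Products over another class, and the trivial case *)

Lemma rep_VF_neq (F' : {set 'I_r}) (FW' : F' \in W pi) : F != F' ->
  exists act : GL k #|F| -> VF k pi F' -> VF k pi F',
    conj_rep (gl_aut FW) (@tauF k r N pi F') act.
Proof.
move=> nF.
have H (x : {i | i \in F'}) := cid2 (rep_Vi FW' nF (valP x)).
pose act x := s2val (H x).
have actP x : conj_rep (gl_aut FW) (@tau k r N pi (val x)) (act x) := s2valP (H x).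
exists (dprod_act (V := fun x : {i | i \in F'} => Vi k pi (val x)) act).
apply: conj_rep_comm => [|g t].
  split=> [g a t u|t|g h t]; apply/ffunP => x; have [[lin0 one0 mul0] _] := actP x;
    rewrite !ffunE /=.
  - exact: lin0.
  - exact: one0.
  - exact: mul0.
(* Conjugation is compatible with products, so the relation is checked factor by factor. *)
rewrite /tauF; elim/big_ind2: _ => [|a b a' b' e e'|x _].
- by rewrite mul1g mulg1.
- by rewrite -mulgA e' mulgA e mulgA.
- by rewrite ffunE; have [_ ->] := actP x; rewrite -!mulgA mulVg mulg1.
Qed.

(** By [outer_root] a non-semisimple root is never positive on the class of the ray it is associated
    to. *)
Lemma classlt_neq (F' : {set 'I_r}) : classlt pi F' F -> F != F'.
Proof.
case=> i [j [iF' jF [rho nss rj]]]; apply/eqP => eF; rewrite -eF in iF'.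
have rE := root_mnmE (exist _ rho (asboolT nss)).
have [_ /(_ j jF) m0] := outer_root pointed (exist _ rho (asboolT nss)) FW iF'.
move/rowP/(_ j): rE; rewrite !mxE m0 /= => /esym/eqP.
by rewrite gt_eqF // ltr_wpDr.
Qed.

(** For $j \ne i$ the exponent of $y_j$ in $y_i y^\rho$ is $\rho_j$, and its positivity would mean
    $v_i < v_j$. *)
Lemma root_poly_outer_nlt i (t : Vi k pi i) : i \notin F ->
  (forall j, j \in F -> ~ vlt pi i j) -> outer_poly pi (deg i) F (root_poly t).
Proof.
move=> iF nlt; apply: outer_poly_sum => rho _; apply/outer_polyZ/outer_polyX.
split=> [|j jF]; first exact: root_mnm_ndeg.
have ji : j != i by apply: contraNneq iF => <-.
have [[_ _ rge] _] := nsrootP rho.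
rewrite mnmE (negbTE ji) addr0; apply/eqP; rewrite absz_eq0.
rewrite eq_le rge // andbT leNgt; apply/negP => rj.
by apply: (nlt j jF); exists (val rho) => //; exact: nsrootP.
Qed.

(** The polynomials added to the variables of $F'$ avoid $F$, hence are fixed by $g$, and the
    variables moved by $g$ and by [tauF t] are disjoint; so the two commute. *)
Lemma rep_VF_trivial (F' : {set 'I_r}) (FW' : F' \in W pi) : ~ classle pi F' F ->
  conj_rep (gl_aut FW) (@tauF k r N pi F') (fun _ x => x).
Proof.
move=> nle; have nF : F' != F by apply/eqP => e; apply: nle; left.
apply: conj_rep_comm => // g t; apply: graut_eqX; apply: mem_enum_rank => [b|j jF].
  have out (a : 'I_#|F|) : enum_val a \notin F'.
    by apply: (W_notin FW FW') (enum_valP a); rewrite eq_sym.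
  rewrite !grautM (tauFX_out pointed) // (gl_aut_in FW g b) (graut_sum (tauF t)).
  by apply: eq_bigr => a _; rewrite (grautZ (tauF t)) (tauFX_out pointed).
rewrite !grautM (gl_aut_out FW g jF); have [jF'|jF'] := boolP (j \in F').
  rewrite (tauFX_in pointed t (exist _ j jF') FW') (grautD (gl_aut FW g)).
  rewrite (gl_aut_out FW g jF) (@gl_aut_fix g (deg j)) //.
  apply: root_poly_outer_nlt => // l lF lt; apply: nle; right.
  by exists j, l.
by rewrite (tauFX_out pointed) // (gl_aut_out FW g jF).
Qed.

End GroupActions.

Theorem theorem6p17 (k : closedFieldType) (hchar : [pchar k] =i pred0)
    (d : nat) (Delta : set (set 'cV[rat]_d)) (hDelta : complete_fan Delta)
    (r : nat) (v : 'M[int]_(d, r)) (hv : is_rays Delta v)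
    (N : zmodType) (pi : {additive 'rV[int]_r -> N})
    (hpi : short_exact v pi)
    (F F' : {set 'I_r}) (FW : F \in W pi) (FW' : F' \in W pi) :
  [/\ (* a *)
      exists2 act : GL k #|F| -> VF k pi F -> VF k pi F,
        conj_rep (gl_aut FW) (@tauF k r N pi F) act
      & exists s : nat,
          rep_iso act
            (dprod_act (V := fun _ : 'I_s => 'rV[k]_#|F|)
               (fun _ => @dual_act k #|F|)),
      (* b *)
      classlt pi F' F ->
      forall i, i \in F' ->
      exists2 act : GL k #|F| -> Vi k pi i -> Vi k pi i,
        conj_rep (gl_aut FW) (@tau k r N pi i) act
      & exists (s : nat) (e : 'I_s -> nat),
          rep_iso act
            (dprod_act (V := fun j => dhomog #|F| k (e j))
               (fun j => @sym_act k #|F| (e j))),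
      (* c *)
      ~ classle pi F' F ->
      exists2 act : GL k #|F| -> VF k pi F' -> VF k pi F',
        conj_rep (gl_aut FW) (@tauF k r N pi F') act
      & forall g x, act g x = x
    & (* in particular *)
      exists act : GL k #|F| -> VF k pi F' -> VF k pi F',
        conj_rep (gl_aut FW) (@tauF k r N pi F') act].
Proof.
have pointed := ker_ge0_eq0 hDelta hv hpi.
have repF := rep_VF k pointed FW.
split=> //.
- move=> lt i iF'; have nF := classlt_neq pointed FW lt.
  have [act rep actE] := rep_Vi k pointed FW FW' nF iF'.
  by exists act => //; exact: (rep_Vi_sym pointed FW' nF iF' actE).
- move=> nle; exists (fun _ x => x) => //; exact: rep_VF_trivial.
- have [e|nF] := eqVneq F F'; last exact: rep_VF_neq.
  by case: F' / e FW'; have [act rep _] := repF; exists act.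
Qed.
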